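(* Let $M$ be a connected smooth manifold with non-empty boundary. If $g$ is a complete doubling metric on $M$, then $G:=g\cup g$ is a complete metric on the double $\mathsf{D}M$.
   Context: Complete means metrically complete: all Cauchy sequences with respect to the Riemannian distance converge. The double is $\mathsf{D}M=M\cup_{\partial M}M$. Given a Riemannian metric $g$ on $M$ with inward-pointing unit normal $N_g$ along $\partial M$, its normal exponential map provides a geodesic collar neighbourhood $\varrho_g\colon V\to U\subset M$, $\varrho_g(t,p)=\exp_p(tN_g(p))$, with $V\subset[0,\infty)\times\partial M$ an open neighbourhood of $\{0\}\times\partial M$; this collar induces a smooth structure on the topological double, and the resulting smooth manifold is denoted $\mathsf{D}M^g$ (or $\mathsf{D}M$). The metric $g$ is called a doubling metric if the twofold copy $g\cup g$ (equal to $g$ on each copy of $M$) is a smooth Riemannian metric on $\mathsf{D}M^g$. *)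

(* Defs.v *)
From HB Require Import structures.
From mathcomp Require Import all_boot all_order all_algebra.
From mathcomp Require Import all_classical all_reals all_analysis.

Set Implicit Arguments.
Unset Strict Implicit.
Unset Printing Implicit Defensive.

Import Order.TTheory GRing.Theory Num.Theory.
Import numFieldNormedType.Exports.

Local Open Scope classical_set_scope.
Local Open Scope ring_scope.

(* C^k and smoothness through iterated directional derivatives; the domains V
   used below are R and 'rV[R]_n.+1, where this is the usual notion. *)
Fixpoint C_on (R : realType) (V W : normedModType R) (k : nat) (O : set V)
    (f : V -> W) : Prop :=
  (forall x, O x -> {for x, continuous f}) /\
  match k with
  | 0 => True
  | k'.+1 => forall v : V, (forall x, O x -> derivable f x v) /\
                           C_on k' O ('D_v f)
  end.

(* Smoothness on a set that need not be open: local smooth extensions. *)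
Definition smooth_on (R : realType) (V W : normedModType R) (S : set V)
    (f : V -> W) : Prop :=
  forall x, S x -> exists (O : set V) (F : V -> W),
    [/\ open O, O x, forall k, C_on k O F &
        forall y, O y -> S y -> F y = f y].

(* Directional derivative of f : S -> W at x, using only increments that stay
   in S: one-sided at the boundary of a half-space or of an interval. *)
Definition dwithin (R : realType) (V W : normedModType R) (S : set V)
    (f : V -> W) (x v : V) : W :=
  lim ((fun h : R => h^-1 *: (f (x + h *: v) - f x)) @
       within [set h : R | S (x + h *: v)] (0^')).

(* The dimension is n.+1, since a manifold with non-empty boundary has positive
   dimension. chart_map is only meaningful on chart_dom, and chart_inv on
   chart_cod. *)
Record chart (R : realType) (T : Type) (n : nat) := Chart {
  chart_dom : set T;
  chart_map : T -> 'rV[R]_n.+1;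
  chart_inv : 'rV[R]_n.+1 -> T }.

Definition chart_cod (R : realType) (T : Type) (n : nat) (c : chart R T n) :
  set 'rV[R]_n.+1 := chart_map c @` chart_dom c.

Definition half_space (R : realType) (n : nat) : set 'rV[R]_n.+1 :=
  [set x | 0 <= x ord0 ord0].

Definition open_in_half_space (R : realType) (n : nat) (S : set 'rV[R]_n.+1) :=
  exists O : set 'rV[R]_n.+1, open O /\ S = O `&` @half_space R n.

Definition is_chart (R : realType) (T : topologicalType) (n : nat)
    (c : chart R T n) : Prop :=
  [/\ open (chart_dom c),
      open (chart_cod c) \/ open_in_half_space (chart_cod c),
      forall p, chart_dom c p -> chart_inv c (chart_map c p) = p,
      {within chart_dom c, continuous (chart_map c)} &
      {within chart_cod c, continuous (chart_inv c)}].

(* The coordinate expression of F : S -> T' and the set on which it lives. *)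
Definition coord_map (R : realType) (T T' : Type) (n : nat) (c : chart R T n)
    (c' : chart R T' n) (F : T -> T') : 'rV[R]_n.+1 -> 'rV[R]_n.+1 :=
  fun x => chart_map c' (F (chart_inv c x)).

Definition coord_dom (R : realType) (T T' : Type) (n : nat) (c : chart R T n)
    (c' : chart R T' n) (S : set T) (F : T -> T') : set 'rV[R]_n.+1 :=
  chart_map c @` (S `&` chart_dom c `&` F @^-1` chart_dom c').

Definition smooth_map (R : realType) (T T' : topologicalType) (n : nat)
    (A : set (chart R T n)) (A' : set (chart R T' n)) (S : set T)
    (F : T -> T') : Prop :=
  {within S, continuous F} /\
  forall c c', A c -> A' c' ->
    smooth_on (coord_dom c c' S F) (coord_map c c' F).

(* T is a smooth manifold with (possibly empty) boundary, with smooth structure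
   given by the (not necessarily maximal) atlas A. *)
Definition smooth_manifold (R : realType) (T : topologicalType) (n : nat)
    (A : set (chart R T n)) : Prop :=
  [/\ hausdorff_space T, @second_countable T,
      forall c, A c -> is_chart c,
      forall p, exists2 c, A c & chart_dom c p &
      forall c c', A c -> A c' ->
        smooth_on (coord_dom c c' setT id) (coord_map c c' id)].

Definition bdry (R : realType) (T : Type) (n : nat) (A : set (chart R T n)) :
    set T :=
  [set p | exists2 c, A c &
    [/\ chart_dom c p, open_in_half_space (chart_cod c) &
        chart_map c p ord0 ord0 = 0]].

(* A covariant 2-tensor field, as its family of matrices in the charts. *)
Definition tensor_field (R : realType) (T : Type) (n : nat) :=
  chart R T n -> 'rV[R]_n.+1 -> 'M[R]_n.+1.

Definition bilin (R : realType) (n : nat) (B : 'M[R]_n.+1)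
    (v w : 'rV[R]_n.+1) : R := (v *m B *m w^T) ord0 ord0.

(* g is the pullback of g' by F : T -> T'. *)
Definition is_pullback (R : realType) (T T' : Type) (n : nat)
    (A : set (chart R T n)) (A' : set (chart R T' n)) (F : T -> T')
    (g' : tensor_field R T' n) (g : tensor_field R T n) : Prop :=
  forall c c', A c -> A' c' ->
  let S := coord_dom c c' setT F in let f := coord_map c c' F in
  forall x, S x -> forall v w,
    bilin (g c x) v w = bilin (g' c' (f x)) (dwithin S f x v) (dwithin S f x w).

(* The pullback by the identity is the transformation law between charts. *)
Definition riemannian_metric (R : realType) (T : topologicalType) (n : nat)
    (A : set (chart R T n)) (g : tensor_field R T n) : Prop :=
  is_pullback A A id g g /\
  forall c, A c ->
    smooth_on (chart_cod c) (g c) /\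
    forall x, chart_cod c x ->
      (g c x)^T = g c x /\ forall v, v != 0 -> 0 < bilin (g c x) v v.

Section curves.
Variables (R : realType) (T : topologicalType) (n : nat).
Variables (A : set (chart R T n)) (g : tensor_field R T n).

Definition curve_dom (c : chart R T n) (a b : R) (gamma : R -> T) : set R :=
  `[a, b] `&` gamma @^-1` chart_dom c.

Definition curve_coord (c : chart R T n) (gamma : R -> T) : R -> 'rV[R]_n.+1 :=
  fun s => chart_map c (gamma s).

Definition velocity (c : chart R T n) (a b : R) (gamma : R -> T) (s : R) :
    'rV[R]_n.+1 :=
  dwithin (curve_dom c a b gamma) (curve_coord c gamma) s 1.

Definition smooth_curve (a b : R) (gamma : R -> T) : Prop :=
  {within `[a, b], continuous gamma} /\
  forall c, A c -> smooth_on (curve_dom c a b gamma) (curve_coord c gamma).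

Definition is_speed (a b : R) (gamma : R -> T) (v : R -> R) : Prop :=
  forall c s, A c -> curve_dom c a b gamma s ->
    v s = Num.sqrt (bilin (g c (curve_coord c gamma s))
                      (velocity c a b gamma s) (velocity c a b gamma s)).

(* piecewise_curve q p l: some piecewise smooth curve, given as a concatenation
   of smooth ones, leads from p to q and has length l. *)
Inductive piecewise_curve (q : T) : T -> \bar R -> Prop :=
| PwNil : piecewise_curve q q 0%E
| PwCons (a b : R) (gamma : R -> T) (v : R -> R) (l : \bar R) :
    a < b -> smooth_curve a b gamma -> is_speed a b gamma v ->
    piecewise_curve q (gamma b) l ->
    piecewise_curve q (gamma a)
      (\int[lebesgue_measure]_(s in `[a, b]) (v s)%:E + l)%E.

Definition riemannian_dist (p q : T) : \bar R :=
  ereal_inf [set l | piecewise_curve q p l].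

Definition complete_metric : Prop :=
  forall u : nat -> T,
    (forall e : R, 0 < e -> exists N : nat, forall i j : nat,
       (N <= i)%N -> (N <= j)%N -> (riemannian_dist (u i) (u j) < e%:E)%E) ->
    exists l : T, forall e : R, 0 < e -> exists N : nat, forall i : nat,
       (N <= i)%N -> (riemannian_dist (u i) l < e%:E)%E.

Definition metric_deriv (c : chart R T n) (i j k : 'I_n.+1)
    (x : 'rV[R]_n.+1) : R^o :=
  dwithin (chart_cod c) (fun y => g c y j k : R^o) x (delta_mx ord0 i).

Definition christoffel (c : chart R T n) (k i j : 'I_n.+1)
    (x : 'rV[R]_n.+1) : R :=
  2^-1 * \sum_l invmx (g c x) k l *
    (metric_deriv c i j l x + metric_deriv c j i l x - metric_deriv c l i j x).

Definition geodesic (a b : R) (gamma : R -> T) : Prop :=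
  smooth_curve a b gamma /\
  forall c, A c -> forall s, curve_dom c a b gamma s ->
    let x' := velocity c a b gamma in
    let x'' := dwithin (curve_dom c a b gamma) x' s 1 in
    forall k, x'' ord0 k +
      \sum_i \sum_j christoffel c k i j (curve_coord c gamma s) *
                    x' s ord0 i * x' s ord0 j = 0.

Definition inward_unit_normal (c : chart R T n) (p : T) (nu : 'rV[R]_n.+1) :
    Prop :=
  let B := g c (chart_map c p) in
  [/\ bilin B nu nu = 1,
      forall w : 'rV[R]_n.+1, w ord0 ord0 = 0 -> bilin B nu w = 0 &
      0 < nu ord0 ord0].

(* exp_p (t N_g(p)) is defined and equal to q. The geodesic runs on [0, b] with
   b > 0 so that its initial velocity makes sense also when t = 0. *)
Definition normal_exp (t : R) (p q : T) : Prop :=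
  exists (b : R) (gamma : R -> T),
    [/\ 0 < b, 0 <= t <= b, geodesic 0 b gamma,
        gamma 0 = p /\ gamma t = q &
        forall c, A c -> chart_dom c p ->
          inward_unit_normal c p (velocity c 0 b gamma 0)].

End curves.

Definition set_coord0 (R : realType) (n : nat) (t : R) (x : 'rV[R]_n.+1) :
    'rV[R]_n.+1 :=
  \row_j (if j == ord0 then t else x ord0 j).

Definition cylinder (R : realType) (T : topologicalType) (n : nat)
    (A : set (chart R T n)) : set (R * T) :=
  [set z | 0 <= z.1 /\ bdry A z.2].

(* The product chart of [0, oo[ x bdry induced by a chart c of T. *)
Definition cylinder_chart (R : realType) (T : topologicalType) (n : nat)
    (A : set (chart R T n)) (c : chart R T n) : chart R (R * T)%type n :=
  Chart (cylinder A `&` [set z | chart_dom c z.2])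
        (fun z => set_coord0 z.1 (chart_map c z.2))
        (fun x => (x ord0 ord0, chart_inv c (set_coord0 0 x))).

Definition cylinder_atlas (R : realType) (T : topologicalType) (n : nat)
    (A : set (chart R T n)) : set (chart R (R * T)%type n) :=
  cylinder_chart A @` A.

(* rho : V -> U := rho(V) is the geodesic collar neighbourhood of g: the normal
   exponential map, a diffeomorphism with inverse sigma. *)
Definition geodesic_collar (R : realType) (T : topologicalType) (n : nat)
    (A : set (chart R T n)) (g : tensor_field R T n) (V : set (R * T))
    (rho : R * T -> T) (sigma : T -> R * T) : Prop :=
  [/\ (exists2 O : set (R * T), open O & V = O `&` cylinder A) /\
        (forall p, bdry A p -> V (0, p)),
      forall t p, V (t, p) -> normal_exp A g t p (rho (t, p)),
      open (rho @` V),
      forall z, V z -> sigma (rho z) = z &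
      smooth_map (cylinder_atlas A) A V rho /\
        smooth_map A (cylinder_atlas A) (rho @` V) sigma].

Section double.
Local Open Scope quotient_scope.
Variables (R : realType) (T : topologicalType) (n : nat).
Variable A : set (chart R T n).

Definition double_rel (x y : T * bool) : bool :=
  (x.1 == y.1) && ((x.2 == y.2) || `[< bdry A x.1 >]).

Lemma double_rel_refl : reflexive double_rel.
Proof. by move=> x; rewrite /double_rel !eqxx. Qed.

Lemma double_rel_sym : symmetric double_rel.
Proof.
move=> x y; rewrite /double_rel eq_sym.
by case: eqP => //= ->; rewrite [y.2 == _]eq_sym.
Qed.

Lemma double_rel_trans : transitive double_rel.
Proof.
move=> y x z; rewrite /double_rel => /andP[/eqP-> Hxy] /andP[/eqP<- Hyz].
rewrite eqxx /=; case/orP: Hxy => [/eqP->//|->]; exact: orbT.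
Qed.

Definition double_equiv : equiv_rel (T * bool)%type :=
  EquivRel double_rel double_rel_refl double_rel_sym double_rel_trans.

Definition manifold_double : Type := quotient_topology {eq_quot double_equiv}.

HB.instance Definition _ :=
  Topological.copy manifold_double (quotient_topology {eq_quot double_equiv}).

Definition copy_incl (b : bool) (p : T) : manifold_double :=
  \pi_({eq_quot double_equiv}) (p, b).

Definition fold (q : manifold_double) : T :=
  (repr (q : quotient_topology {eq_quot double_equiv})).1.

(* The copy containing q; an arbitrary one if q lies on the boundary. *)
Definition side (q : manifold_double) : bool :=
  (repr (q : quotient_topology {eq_quot double_equiv})).2.

Definition interior_chart (b : bool) (c : chart R T n) :
    chart R manifold_double n :=
  Chart [set q | [/\ chart_dom c (fold q), ~ bdry A (fold q) & side q = b]]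
        (fun q => chart_map c (fold q))
        (fun x => copy_incl b (chart_inv c x)).

(* The collars of the two copies are glued into a two-sided collar, with
   parameter t >= 0 in the copy true and t <= 0 in the copy false. *)
Definition collar_chart (V : set (R * T)) (rho : R * T -> T)
    (sigma : T -> R * T) (c : chart R T n) : chart R manifold_double n :=
  Chart [set q | (rho @` V) (fold q) /\ chart_dom c (sigma (fold q)).2]
        (fun q => let: (t, p) := sigma (fold q) in
                  set_coord0 (if side q then t else - t) (chart_map c p))
        (fun x => copy_incl (0 <= x ord0 ord0)
                    (rho (`|x ord0 ord0|, chart_inv c (set_coord0 0 x)))).

Definition double_atlas (V : set (R * T)) (rho : R * T -> T)
    (sigma : T -> R * T) : set (chart R manifold_double n) :=
  [set d | exists2 c, A c &
    (exists b, d = interior_chart b c) \/ d = collar_chart V rho sigma c].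

(* G = g u g, i.e. G restricts to g on each copy of T. *)
Definition twofold_copy (V : set (R * T)) (rho : R * T -> T)
    (sigma : T -> R * T) (g : tensor_field R T n)
    (G : tensor_field R manifold_double n) : Prop :=
  forall b, is_pullback A (double_atlas V rho sigma) (copy_incl b) G g.

Definition doubling_metric (V : set (R * T)) (rho : R * T -> T)
    (sigma : T -> R * T) (g : tensor_field R T n) : Prop :=
  exists2 G, riemannian_metric (double_atlas V rho sigma) G &
    twofold_copy V rho sigma g G.

End double.

(* Main.v *)
From HB Require Import structures.
Require Import Defs.
From mathcomp Require Import all_boot all_order all_algebra.
From mathcomp Require Import all_classical all_reals all_analysis.
From mathcomp Require Import ring lra.

Set Implicit Arguments.
Unset Strict Implicit.
Unset Printing Implicit Defensive.

Import Order.TTheory GRing.Theory Num.Theory.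
Import numFieldNormedType.Exports.

Local Open Scope classical_set_scope.
Local Open Scope ring_scope.

(** The two inclusions [copy_incl A b] of M into the double and the folding map
    [fold] from the double to M do not increase distances, and this transports
    completeness.  A Cauchy sequence of the double folds to a Cauchy sequence
    of M, which has a limit l.  Infinitely many terms of the sequence lie in one
    copy b of M, and those are no further from the copy of l in b than their
    folds are from l; so a subsequence converges, hence the whole sequence does.

    An inclusion maps smooth curves to smooth curves of the same speed
    ([pushforward_curve], [dist_copy_le]).  The folding map does not: a smooth
    curve may cross the boundary infinitely often, and its fold is then not
    piecewise smooth.  The fold still has, at every time and on either side, a
    derivative of norm the speed of the curve ([fold_one_sided_derivative]).
    Off the boundary this is clear.  At a time where the curve meets the
    boundary, let (t', y') be its velocity in collar coordinates.  Folding is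
    (t, y) |-> (|t|, y) there, so the one-sided derivatives of the fold are
    (|t'|, y') and (-|t'|, y').  Each of them is the velocity or its mirror
    image, and the reflection t |-> -t preserves the metric along t = 0, because
    the metric of the double pulls back to the same g under both inclusions
    ([collar_chart_metric]).

    The images of the charts of M are locally convex, so straight segments in a
    chart turn this infinitesimal statement into a bound: the distance between
    the folds at the times s and s + h is at most |h| (v s + e) for h small
    ([dist_chart_le], [dist_lt_quotient]).  Such bounds at all times add up to
    the integral of v by a supremum argument ([dist_le_local_length]), which
    also requires v to be continuous ([speed_continuous]).

    Two points deserve care.  The domains of the charts of the double are open
    only once the boundary of M is known to be closed, which follows from the
    invariance of the boundary ([boundary_not_interior]).  And a tensor field
    that restricts to g on both copies is determined as a quadratic form
    ([twofold_unique]), so that its speeds are those of the Riemannian metric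
    provided by the doubling hypothesis. *)

(** * Differentiability and difference quotients *)

Lemma cvg_near_eq (T : Type) (U : topologicalType) (F : set_system T)
    {FF : Filter F} (f g : T -> U) (l : U) :
  (\forall x \near F, g x = f x) -> f @ F --> l -> g @ F --> l.
Proof.
move=> fg fl A Al; have h : F (f @^-1` A) := fl A Al.
by apply: (filterS2 _ _ fg h) => x; rewrite /= => ->.
Qed.

Lemma coord_cvg (R : realType) (m n : nat) (T : Type) (F : set_system T)
    {FF : Filter F} (f : T -> 'M[R]_(m, n)) (l : 'M[R]_(m, n)) i j :
  f t @[t --> F] --> l -> f t i j @[t --> F] --> l i j.
Proof.
move=> fl; apply: (cvg_comp f (fun M : 'M[R]_(m, n) => M i j) fl).
exact: (@coord_continuous R m n i j l).
Qed.

Lemma mx_cvg (R : realType) (m n : nat) (T : Type) (F : set_system T)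
    {FF : Filter F} (f : T -> 'M[R]_(m, n)) (l : 'M[R]_(m, n)) :
  (forall i j, f t i j @[t --> F] --> l i j) -> f t @[t --> F] --> l.
Proof.
move=> fl; apply/cvgrPdist_le => e e0.
have : \forall t \near F, forall i j, `|l i j - f t i j| <= e.
  apply: filter_forall => i; apply: filter_forall => j.
  by have /cvgrPdist_le := fl i j; exact.
apply: filterS => t H; rewrite [leLHS]/Num.Def.normr /= mx_normrE.
by apply: bigmax_le; [exact: ltW | move=> [i j] _ /=; rewrite !mxE; exact: H].
Qed.

Lemma frechet_differentiable (R : realType) (V W : normedModType R) (f : V -> W)
    (L : {linear V -> W}) (x : V) : continuous L ->
  (forall e : R, 0 < e ->
     \forall h \near 0, `|f (h + x) - f x - L h| <= e * `|h|) ->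
  differentiable f x.
Proof.
move=> cL H.
have E : f \o shift x = cst (f x) + L +o_ 0 id.
  apply/eqaddoP => e e0; near=> h.
  have -> : (f \o shift x - (cst (f x) + L)) h = f (h + x) - f x - L h.
    by rewrite /= opprD addrA.
  by near: h; apply: H.
by apply/diff_locallyP; rewrite (diff_unique cL E); split.
Unshelve. all: by end_near. Qed.

Lemma differentiable_le (R : realType) (V W : normedModType R) (f : V -> W)
    (x : V) : differentiable f x -> forall e : R, 0 < e ->
  \forall y \near x, `|f y - f x - 'd f x (y - x)| <= e * `|y - x|.
Proof.
move=> /diff_locallyP[_ /eqaddoP H] e e0.
rewrite (near_shift 0 x); near=> h; rewrite /= subr0 addrK.
have : `|(f \o shift x - (cst (f x) + 'd f x)) h| <= e * `|h|.
  by near: h; exact: H.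
by rewrite /= opprD addrA.
Unshelve. all: by end_near. Qed.

(** The chain rule along an arbitrary filter of increments. One form covers
    two-sided derivatives, one-sided derivatives and derivatives within a
    set. *)
Lemma cvg_quotient_comp (R : realType) (V W : normedModType R) (F : V -> W)
    (x w : V) (H : set_system R) (FH : Filter H) (k : R -> V) :
  differentiable F x -> (\forall h \near H, h != 0) ->
  k h @[h --> H] --> x -> h^-1 *: (k h - x) @[h --> H] --> w ->
  h^-1 *: (F (k h) - F x) @[h --> H] --> 'd F x w.
Proof.
move=> dF Hn0 kx kw.
have cd : 'd F x (h^-1 *: (k h - x)) @[h --> H] --> 'd F x w.
  by apply: continuous_cvg => //; apply: (diff_continuous dF).
suff E : h^-1 *: (F (k h) - F x) - 'd F x (h^-1 *: (k h - x)) @[h --> H] --> 0.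
  have Ecd := @cvgD _ _ _ _ FH _ _ _ _ E cd; rewrite add0r in Ecd.
  refine (cvg_near_eq _ Ecd).
  by near=> h; rewrite /= subrK.
apply/cvgrPdist_le => e e0.
have w0 : 0 < `|w| + 1 by rewrite ltr_wpDl.
near=> h; rewrite sub0r normrN linearZ -scalerBr.
have A : `|F (k h) - F x - 'd F x (k h - x)| <= e / (`|w| + 1) * `|k h - x|.
  by near: h; exact: (kx _ (differentiable_le dF (divr_gt0 e0 w0))).
have B : `|h^-1 *: (k h - x)| <= `|w| + 1.
  rewrite -[X in `|X|](subrK w) addrC (le_trans (ler_normD _ _))// lerD2l.
  rewrite distrC.
  by near: h; move/cvgrPdist_le: kw; apply.
rewrite normrZ; rewrite normrZ in B.
apply: (le_trans (ler_wpM2l _ A)); first exact: normr_ge0.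
rewrite mulrCA -[leRHS](divfK (lt0r_neq0 w0)) ler_wpM2l//.
by rewrite divr_ge0 ?ltW.
Unshelve. all: by end_near. Qed.

Lemma cvg_line (R : realType) (V : normedModType R) (x v : V) :
  h *: v + x @[h --> (0 : R)^'] --> x.
Proof.
apply: (@cvg_trans _ (h *: v + x @[h --> (0 : R)])).
  move=> A h; have {}h : nbhs (0 : R) ((fun h => h *: v + x) @^-1` A) := h.
  by rewrite /= /dnbhs /within; apply: filterS h.
suff : h *: v + x @[h --> (0 : R)] --> 0 *: v + x by rewrite scale0r add0r.
by apply: cvgD; [apply: cvgZr_tmp | exact: cvg_cst].
Qed.

Lemma is_derive_diff_comp (R : realType) (U V W : normedModType R) (k : U -> V)
    (F : V -> W) (x v : U) :
  derivable k x v -> {for x, continuous k} -> differentiable F (k x) ->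
  is_derive x v (F \o k) ('d F (k x) ('D_v k x)).
Proof.
move=> dk ck dF.
have Q : h^-1 *: ((F \o k) (h *: v + x) - (F \o k) x) @[h --> 0^'] -->
    'd F (k x) ('D_v k x).
  apply: (@cvg_quotient_comp _ _ _ _ _ _ _ _ (fun h => k (h *: v + x))) => //.
  - by near=> h; near: h; exact: nbhs_dnbhs_neq.
  - by apply: continuous_cvg; [exact: ck | exact: cvg_line].
by apply: DeriveDef; [apply/cvg_ex; eexists; exact: Q | apply/cvg_lim].
Unshelve. all: by end_near. Qed.

Lemma is_derive_line (R : realType) (V : normedModType R) (f : V -> R)
    (y u : V) (t : R) : derivable f (t *: u + y) u ->
  is_derive t 1 (fun s : R => f (s *: u + y)) ('D_u f (t *: u + y)).
Proof.
move=> df.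
have E : (fun h : R => h^-1 *: (((fun s : R => f (s *: u + y)) \o shift t)
            (h *: (1 : R)) - f (t *: u + y))) =
         (fun h => h^-1 *: ((f \o shift (t *: u + y)) (h *: u)
            - f (t *: u + y))).
  by apply/funext => h; rewrite /= [_ *: 1]mulr1 scalerDl addrA.
by apply: DeriveDef; rewrite /derivable ?/derive E.
Qed.

(** Both signs of [s] are allowed, so that the lemma applies to the
    coordinates of a vector. *)
Lemma mean_value_line (R : realType) (V : normedModType R) (f : V -> R)
    (y u : V) (s : R) :
  (forall t : R, `|t| <= `|s| -> derivable f (t *: u + y) u) ->
  exists2 c : R, `|c| <= `|s| &
    f (s *: u + y) - f y = s * 'D_u f (c *: u + y).
Proof.
move=> df; pose phi t := f (t *: u + y).
have dphi (t : R) : `|t| <= `|s| -> is_derive t 1 phi ('D_u f (t *: u + y)).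
  by move=> ts; apply: is_derive_line; apply: df.
have cphi (a b : R) : (forall t, t \in `[a, b] -> `|t| <= `|s|) ->
    {within `[a, b], continuous phi}.
  move=> ab; apply: derivable_within_continuous => t tab.
  by have := dphi t (ab t tab) => -[].
have phi0 : phi 0 = f y by rewrite /phi scale0r add0r.
have [s0|s0] := leP 0 s.
  have ab (t : R) : t \in `[0, s] -> `|t| <= `|s|.
    by rewrite in_itv /= => /andP[t0 ts]; rewrite !ger0_norm// (le_trans t0).
  have [c cs] := MVT_segment s0
    (fun t ts => dphi t (ab t (subset_itv_oo_cc ts))) (cphi _ _ ab).
  rewrite phi0 subr0 mulrC => E; exists c => //; exact: ab.
have ab (t : R) : t \in `[s, 0] -> `|t| <= `|s|.
  rewrite in_itv /= => /andP[t0 ts].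
  by rewrite !ler0_norm ?lerN2// ltW.
have [c cs] := MVT_segment (ltW s0)
  (fun t ts => dphi t (ab t (subset_itv_oo_cc ts))) (cphi _ _ ab).
rewrite phi0 sub0r mulrN => E; exists c; first exact: ab.
by apply: oppr_inj; rewrite opprB E mulrC.
Qed.

Lemma rV_coord_le (R : realType) (n : nat) (x : 'rV[R]_n) (i : 'I_n) :
  `|x ord0 i| <= `|x|.
Proof.
rewrite [leRHS]/Num.Def.normr /= mx_normrE.
exact: (le_bigmax _ (fun ij => `|x ij.1 ij.2|) (ord0, i)).
Qed.

Lemma rV_norm_le (R : realType) (n : nat) (x : 'rV[R]_n) (e : R) : 0 <= e ->
  (forall i, `|x ord0 i| <= e) -> `|x| <= e.
Proof.
move=> e0 H; rewrite [leLHS]/Num.Def.normr /= mx_normrE; apply: bigmax_le => //.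
by move=> [i j] _ /=; rewrite (ord1 i).
Qed.

(** From x to v + x one moves along one coordinate axis at a time; the mean
    value theorem compares each move with the partial derivative at x. *)
Lemma continuous_partials_differentiable (R : realType) (n : nat)
    (f : 'rV[R]_n.+1 -> R) (x : 'rV[R]_n.+1) :
  (forall j, \forall y \near x, derivable f y (delta_mx ord0 j)) ->
  (forall j, {for x, continuous ('D_(delta_mx ord0 j) f)}) ->
  differentiable f x.
Proof.
move=> df cf.
pose e j : 'rV[R]_n.+1 := delta_mx ord0 j.
pose d (v : 'rV[R]_n.+1) : R := \sum_j v ord0 j * 'D_(e j) f x.
have lin_d : linear d.
  move=> a u v; rewrite /d scaler_sumr -big_split /=.
  by apply: eq_bigr => j _; rewrite !mxE mulrDl -mulrA.
pose dM := GRing.isLinear.Build _ _ _ _ _ lin_d.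
pose L : {linear _ -> _} := HB.pack d dM.
have cL : continuous L.
  apply: continuous_big => [|j _ v]; first exact: add_continuous.
  by apply: (@continuousM R _ (fun v : 'rV[R]_n.+1 => v ord0 j) (cst _));
    [exact: coord_continuous | exact: cst_continuous].
suff [] : differentiable f x by [].
apply: (frechet_differentiable cL) => eps eps0.
have N0 : 0 < (n.+1%:R : R) by rewrite ltr0n.
pose eta := eps / n.+1%:R.
have eta0 : 0 < eta by exact: divr_gt0.
have : \forall y \near x, forall j, derivable f y (e j) /\
     `|'D_(e j) f x - 'D_(e j) f y| <= eta.
  apply: (@filter_forall _ _ _ (nbhs x) (nbhs_filter x)) => j.
  near=> y; split; first by near: y; exact: df.
  near: y; have := cf j; rewrite /continuous_at => /cvgrPdist_le; exact.
move=> /nbhs_ballP[r /= r0 rP].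
near=> v.
have vr : `|v| < r by near: v; exact: (@nbhs0_lt _ 'rV[R]_n.+1 r).
(* the corners of the broken line from 0 to v along the axes *)
pose p (j : nat) : 'rV[R]_n.+1 := \row_i (if (i < j)%N then v ord0 i else 0).
have pS (j : 'I_n.+1) : p j.+1 = v ord0 j *: e j + p j.
  apply/rowP => i; rewrite !mxE eqxx /= ltnS leq_eqVlt.
  have [<-|ij] := eqVneq i j; first by rewrite eqxx ltnn mulr1 addr0.
  rewrite /= mulr0 add0r; case: eqP => // E; case/eqP: ij; exact: val_inj.
have step (j : 'I_n.+1) :
    `|f (p j.+1 + x) - f (p j + x) - v ord0 j * 'D_(e j) f x| <= eta * `|v|.
  have small c : `|c| <= `|v ord0 j| -> ball x r (c *: e j + (p j + x)).
    move=> cv; rewrite -ball_normE /= addrA addrC opprD addrA subrr sub0r.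
    rewrite normrN; apply: le_lt_trans vr; apply: rV_norm_le => // i.
    rewrite !mxE eqxx /=; have [<-|ij] := eqVneq i j.
      by rewrite ltnn mulr1 addr0 (le_trans cv)// rV_coord_le.
    rewrite mulr0 add0r; case: ifP => _; first exact: rV_coord_le.
    by rewrite normr0.
  have [c cv E] : exists2 c : R, `|c| <= `|v ord0 j| &
     f (v ord0 j *: e j + (p j + x)) - f (p j + x) =
       v ord0 j * 'D_(e j) f (c *: e j + (p j + x)).
    by apply: mean_value_line => t tv; have [] := rP _ (small t tv) j.
  rewrite pS -(addrA (_ *: _)) E -mulrBr normrM mulrC ler_pM// ?rV_coord_le//.
  by rewrite distrC; have [] := rP _ (small c cv) j.
have pE : v = p n.+1 by apply/rowP => i; rewrite mxE ltn_ord.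
have p0 : p 0%N = 0 by apply/rowP => i; rewrite !mxE.
have -> : f (v + x) - f x - L v =
    \sum_(j < n.+1) (f (p j.+1 + x) - f (p j + x) - v ord0 j * 'D_(e j) f x).
  rewrite big_split /= sumrN -[\sum_(i < n.+1) v _ _ * _]/(L v); congr (_ - _).
  rewrite -(big_mkord xpredT (fun j => f (p j.+1 + x) - f (p j + x))).
  by rewrite telescope_sumr// -pE p0 add0r.
apply: (le_trans (ler_norm_sum _ _ _)).
apply: (@le_trans _ _ (\sum_(j < n.+1) eta * `|v|)); first exact: ler_sum.
rewrite sumr_const card_ord -mulr_natl mulrA /eta.
by rewrite mulrCA mulfV ?mulr1// gt_eqF.
Unshelve. all: by end_near. Qed.

(** * Functions of class C^k *)

Section c_on.
Variables (R : realType) (V W : normedModType R).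
Implicit Types (O : set V) (f g : V -> W).

Lemma C_on_continuous k O f x : C_on k O f -> O x -> {for x, continuous f}.
Proof. by case: k => [|k] [cf _]; apply: cf. Qed.

Lemma C_on_derivable k O f x v : C_on k.+1 O f -> O x -> derivable f x v.
Proof. by move=> [_ /(_ v)[df _]]; exact: df. Qed.

Lemma C_on_derive k O f v : C_on k.+1 O f -> C_on k O ('D_v f).
Proof. by move=> [_ /(_ v)[]]. Qed.

Lemma C_on_pred k O f : C_on k.+1 O f -> C_on k O f.
Proof.
elim: k f => [|k IH] f [cf df]; first by split.
split=> // v; have [dvf Cdvf] := df v; split=> //; exact: IH.
Qed.

Lemma C_on_subset k (O O' : set V) f : O' `<=` O -> C_on k O f -> C_on k O' f.
Proof.
move=> sO; elim: k f => [|k IH] f [cf df]; first by split=> // x /sO /cf.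
split=> [x /sO /cf //|v]; have [dvf Cdvf] := df v.
by split; [move=> y /sO; exact: dvf | exact: IH].
Qed.

Lemma near_eq_continuous f g x :
  {near x, f =1 g} -> {for x, continuous f} -> {for x, continuous g}.
Proof.
move=> fg cf; have fgx : f x = g x := nbhs_singleton fg.
have cf' : f y @[y --> x] --> g x by rewrite -fgx.
apply: cvg_near_eq cf'.
by apply: filterS fg => y ->.
Qed.

Lemma C_on_ext k O f g : open O -> (forall x, O x -> f x = g x) ->
  C_on k O f -> C_on k O g.
Proof.
move=> oO; elim: k f g => [|k IH] f g fg [cf df].
  split=> // x Ox; apply: near_eq_continuous (cf x Ox).
  by apply: filterS (open_nbhs_nbhs (conj oO Ox)) => y /fg.
have nfg x : O x -> {near x, f =1 g}.
  by move=> Ox; apply: filterS (open_nbhs_nbhs (conj oO Ox)) => y /fg.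
split=> [x Ox|v]; first by apply: near_eq_continuous (cf x Ox); exact: nfg.
have [dvf Cdvf] := df v; split=> [x Ox|].
  by apply: (near_eq_derivable (nfg x Ox)); exact: dvf.
apply: IH Cdvf => x Ox; apply: near_eq_derive; exact: nfg.
Qed.

Lemma C_onD k O f g : open O -> C_on k O f -> C_on k O g -> C_on k O (f + g).
Proof.
move=> oO; elim: k f g => [|k IH] f g [cf df] [cg dg].
  by split=> // x Ox; apply: continuousD; [exact: cf | exact: cg].
split=> [x Ox|v]; first by apply: continuousD; [exact: cf | exact: cg].
have [dvf Cdvf] := df v; have [dvg Cdvg] := dg v.
split=> [x Ox|]; first by apply: derivableD; [exact: dvf | exact: dvg].
apply: C_on_ext (IH _ _ Cdvf Cdvg) => // x Ox.
by rewrite deriveD; [|exact: dvf|exact: dvg].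
Qed.

Lemma C_on_cst k O (c : W) : open O -> C_on k O (cst c).
Proof.
move=> oO; elim: k c => [|k IH] c; first split=> // x _.
  exact: cst_continuous.
split=> [x _|v]; first exact: cst_continuous.
split=> [x _|]; first exact: derivable_cst.
by apply: C_on_ext (IH 0) => // x _; rewrite derive_cst.
Qed.

Lemma C_on_sum k O (I : Type) (r : seq I) (f : I -> V -> W) : open O ->
  (forall i, C_on k O (f i)) -> C_on k O (fun x => \sum_(i <- r) f i x).
Proof.
move=> oO Cf; elim: r => [|i r IH].
  apply: C_on_ext (C_on_cst k 0 oO) => // x _; by rewrite big_nil.
by apply: C_on_ext (C_onD oO (Cf i) IH) => // x _; rewrite big_cons.
Qed.

End c_on.

Lemma C_onM (R : realType) (V : normedModType R) k (O : set V) (f g : V -> R) :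
  open O -> C_on k O f -> C_on k O g -> C_on k O (f * g).
Proof.
move=> oO; elim: k f g => [|k IH] f g Cf Cg; have [cf df] := Cf;
    have [cg dg] := Cg.
  by split=> // x Ox; apply: continuousM; [exact: cf | exact: cg].
split=> [x Ox|v]; first by apply: continuousM; [exact: cf | exact: cg].
have [dvf Cdvf] := df v; have [dvg Cdvg] := dg v.
split=> [x Ox|]; first by apply: derivableM; [exact: dvf | exact: dvg].
apply: C_on_ext (C_onD oO (IH _ _ (C_on_pred Cf) Cdvg)
  (IH _ _ (C_on_pred Cg) Cdvf)) => // x Ox.
by rewrite deriveM; [|exact: dvf|exact: dvg].
Qed.

Lemma continuous_mxP (R : realType) (T : topologicalType) (m n : nat)
    (f : T -> 'M[R]_(m, n)) (x : T) :
  {for x, continuous f} <-> forall i j, {for x, continuous (fun y => f y i j)}.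
Proof.
by split=> [cf i j|cf]; [exact: coord_cvg | apply: mx_cvg].
Qed.

Lemma C_on_mxP (R : realType) (V : normedModType R) (m n : nat) k (O : set V)
    (f : V -> 'M[R]_(m, n)) : open O ->
  C_on k O f <-> forall i j, C_on k O (fun x => f x i j).
Proof.
move=> oO; elim: k f => [|k IH] f.
  split=> [[cf _] i j|cf]; split=> // x Ox.
    by apply: (iffLR (continuous_mxP f x)); exact: cf.
  by apply/continuous_mxP => i j; have [+ _] := cf i j; exact.
split=> [[cf df] i j|cf]; split=> [x Ox|v].
- by apply: (iffLR (continuous_mxP f x)); exact: cf.
- have [dvf Cdvf] := df v; split=> [x Ox|].
    by apply: (iffLR (derivable_mxP f x v)); exact: dvf.
  apply: C_on_ext ((IH _).1 Cdvf i j) => // x Ox.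
  by rewrite (derive_mx (dvf x Ox)) mxE.
- by apply/continuous_mxP => i j; have [+ _] := cf i j; exact.
- have dvf x : O x -> derivable f x v.
    by move=> Ox; apply/derivable_mxP => i j; exact: C_on_derivable (cf i j) Ox.
  split=> //; apply/IH => i j.
  apply: C_on_ext (C_on_derive v (cf i j)) => // x Ox.
  by rewrite (derive_mx (dvf x Ox)) mxE.
Qed.

Lemma C_on_differentiable (R : realType) (n : nat) k (O : set 'rV[R]_n.+1)
    (f : 'rV[R]_n.+1 -> R) x :
  open O -> C_on k.+1 O f -> O x -> differentiable f x.
Proof.
move=> oO Cf Ox; apply: continuous_partials_differentiable => j.
  apply: filterS (open_nbhs_nbhs (conj oO Ox)) => y Oy.
  exact: C_on_derivable Cf Oy.
exact: C_on_continuous (C_on_derive _ Cf) Ox.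
Qed.

Lemma C_on_differentiable_rV (R : realType) (n m : nat) k (O : set 'rV[R]_n.+1)
    (f : 'rV[R]_n.+1 -> 'rV[R]_m) x :
  open O -> C_on k.+1 O f -> O x -> differentiable f x.
Proof.
move=> oO Cf Ox.
have -> : f = \sum_(j < m) (fun y => f y ord0 j *: delta_mx ord0 j).
  by rewrite fct_sumE; apply/funext => y; exact: row_sum_delta.
apply: differentiable_sum => j; apply: differentiableZl.
exact: (C_on_differentiable oO ((C_on_mxP _ _ oO).1 Cf ord0 j) Ox).
Qed.

(** Smoothness of [f] is required to all orders, as the induction on [k]
    replaces [f] by its partial derivatives. *)
Lemma C_on_comp (R : realType) (n : nat) (V : normedModType R) (O : set V)
    (Q : set 'rV[R]_n.+1) (c : V -> 'rV[R]_n.+1) k (f : 'rV[R]_n.+1 -> R) :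
  open O -> open Q -> (forall x, O x -> Q (c x)) ->
  (forall k, C_on k O c) -> (forall k, C_on k Q f) -> C_on k O (f \o c).
Proof.
move=> oO oQ OQ Cc; elim: k f => [|k IH] f Cf.
  split=> // x Ox; apply: continuous_comp.
    exact: C_on_continuous (Cc 0%N) Ox.
  exact: C_on_continuous (Cf 0%N) (OQ _ Ox).
split=> [x Ox|v].
  apply: continuous_comp; first exact: C_on_continuous (Cc 0%N) Ox.
  exact: C_on_continuous (Cf 0%N) (OQ _ Ox).
have D x : O x -> is_derive x v (f \o c) ('d f (c x) ('D_v c x)).
  move=> Ox; apply: is_derive_diff_comp.
  - exact: C_on_derivable (Cc 1%N) Ox.
  - exact: C_on_continuous (Cc 0%N) Ox.
  - exact: (C_on_differentiable oQ (Cf 1%N) (OQ _ Ox)).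
split=> [x /D[]//|].
apply: (@C_on_ext _ _ _ k O (fun x => \sum_j
   (('D_(delta_mx ord0 j) f \o c) * (fun y => 'D_v c y ord0 j)) x)) => //.
  move=> x Ox; have [_ ->] := D x Ox.
  rewrite [in RHS](row_sum_delta ('D_v c x)) linear_sum; apply: eq_bigr => j _.
  have dfx := C_on_differentiable oQ (Cf 1%N) (OQ _ Ox).
  by rewrite linearZ /= -(deriveE _ dfx) [RHS]mulrC.
apply: C_on_sum => // j; apply: C_onM => //.
  by apply: IH => l; apply: C_on_derive.
exact: ((C_on_mxP _ _ oO).1 (C_on_derive v (Cc _)) ord0 j).
Qed.

Lemma C_on_comp_rV (R : realType) (n m : nat) (V : normedModType R) (O : set V)
    (Q : set 'rV[R]_n.+1) (c : V -> 'rV[R]_n.+1) k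
    (f : 'rV[R]_n.+1 -> 'rV[R]_m) :
  open O -> open Q -> (forall x, O x -> Q (c x)) ->
  (forall k, C_on k O c) -> (forall k, C_on k Q f) -> C_on k O (f \o c).
Proof.
move=> oO oQ OQ Cc Cf; apply/C_on_mxP => // i j.
apply: (@C_on_comp _ _ _ _ Q c k (fun y => f y i j)) => // l.
exact: ((C_on_mxP _ _ oQ).1 (Cf l)).
Qed.

(** * Derivatives within relatively open subsets of a half-space *)

(** This is the invertibility of a one-sided inverse of a square matrix. *)
Lemma linear_left_inverse (R : fieldType) (n : nat)
    (f g : {linear 'rV[R]_n -> 'rV[R]_n}) :
  cancel f g -> cancel g f.
Proof.
move=> fK.
have E : lin1_mx f *m lin1_mx g = 1%:M.
  apply/row_matrixP => i; rewrite row_mul row1 -[row i (lin1_mx f)]mul1mx.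
  by rewrite mul1mx mul_rV_lin1 /= rowE mul_rV_lin1 /= fK.
move=> w; rewrite -[g w]mul_rV_lin1 -[LHS]mul_rV_lin1 -mulmxA.
by rewrite (mulmx1C E) mulmx1.
Qed.

Lemma proper_within_dnbhs0 (R : realType) (D : set R) :
  (forall d : R, 0 < d -> exists h, [/\ h != 0, `|h| < d & D h]) ->
  ProperFilter (within D 0^').
Proof.
move=> H; apply: Build_ProperFilter_ex => P [d /= d0 dP].
have [h [h0 hd Dh]] := H d d0; exists h; apply: dP => //=.
by rewrite sub0r normrN.
Qed.

Lemma within_dnbhs0 (R : realType) (D W : set R) :
  (0 : R)^' W -> within D (0 : R)^' W.
Proof. by move=> W0; rewrite /within; apply: filterS W0. Qed.

Lemma within_dnbhs0_neq0 (R : realType) (D : set R) :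
  \forall h \near within D (0 : R)^', h != 0.
Proof. by apply: within_dnbhs0; rewrite /dnbhs /within /=; apply: filterE. Qed.

Lemma cvg_within_dnbhs0 (R : realType) (D : set R) :
  h @[h --> within D (0 : R)^'] --> (0 : R).
Proof.
move=> W W0; apply: within_dnbhs0; have {}W0 : nbhs (0 : R) W := W0.
by rewrite /= /dnbhs /within; apply: filterS W0.
Qed.

(** The difference quotient of [f] along increments staying in [S] sees only
    the values of a smooth extension [F]. *)
Lemma cvg_quotient_within (R : realType) (V W : normedModType R) (S O : set V)
    (f F : V -> W) (x v : V) :
  open O -> O x -> S x -> (forall y, O y -> S y -> F y = f y) ->
  differentiable F x ->
  h^-1 *: (f (x + h *: v) - f x)
    @[h --> within [set h : R | S (x + h *: v)] (0^')] --> 'd F x v.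
Proof.
move=> oO Ox Sx Ff dF; set H := within _ _.
have HF : Filter H by exact: within_filter.
have cv : x + h *: v @[h --> H] --> x.
  have cl : x + h *: v @[h --> (0 : R)^'] --> x.
    by under eq_fun do rewrite addrC; exact: cvg_line.
  by move=> A /cl; apply: cvg_within.
have hO : \forall h \near H, O (x + h *: v).
  by apply: cv; exact: open_nbhs_nbhs.
have hS : \forall h \near H, S (x + h *: v).
  by rewrite /H near_withinE; apply: filterE.
have hn0 : \forall h \near H, h != 0 by exact: within_dnbhs0_neq0.
apply: (cvg_near_eq (f := fun h => h^-1 *: (F (x + h *: v) - F x))); last first.
  apply: cvg_quotient_comp => //.
  apply: cvg_near_eq (cvg_cst v).
  by near=> h; rewrite addrAC subrr add0r scalerA mulVf ?scale1r//; near: h.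
by near=> h; rewrite !Ff//; near: h.
Unshelve. all: by end_near. Qed.

(** [dwithin] is a limit chosen by [lim], so it means something only if the
    filter of admissible increments is proper. *)
Lemma dwithin_diff (R : realType) (V : normedModType R) (m : nat) (S O : set V)
    (f F : V -> 'rV[R]_m) (x v : V) :
  ProperFilter (within [set h : R | S (x + h *: v)] (0^')) ->
  open O -> O x -> S x -> (forall y, O y -> S y -> F y = f y) ->
  differentiable F x -> dwithin S f x v = 'd F x v.
Proof.
move=> PF oO Ox Sx Ff dF; apply: cvg_lim; first exact: norm_hausdorff.
exact: cvg_quotient_within Ox Sx Ff dF.
Qed.

Section relative.
Variables (R : realType) (n : nat).
Implicit Types (S O : set 'rV[R]_n.+1) (x : 'rV[R]_n.+1).

(** The neighbourhoods of a point in the image of a chart, which is open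
    either in the whole space or in the half-space. *)
Definition rel_nbhs S x :=
  nbhs x S \/ half_space x /\ within (@half_space R n) (nbhs x) S.

Lemma rel_nbhs_self S x : rel_nbhs S x -> S x.
Proof.
by case=> [/nbhs_singleton//|[hx /nbhs_singleton]]; apply.
Qed.

Lemma rel_nbhsI S O x : rel_nbhs S x -> nbhs x O -> rel_nbhs (S `&` O) x.
Proof.
move=> [Sx|[hx Sx]] Ox; [left; exact: filterI | right; split=> //].
have Sx' : nbhs x (fun y => half_space y -> S y) := Sx.
have : nbhs x (fun y => half_space y -> (S `&` O) y) by
  apply: filterS2 Sx' Ox => y Sy Oy /Sy.
by [].
Qed.

Lemma rel_nbhsS S S' x : S `<=` S' -> rel_nbhs S x -> rel_nbhs S' x.
Proof.
move=> SS' [Sx|[hx Sx]]; [left | right; split=> //].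
  exact: filterS Sx.
have Sx' : nbhs x (fun y => half_space y -> S y) := Sx.
by apply: (filterS _ Sx') => y Sy /Sy /SS'.
Qed.

(** In the half-space the increments [h] have the sign of the normal component
    of [v]: a line that crosses the boundary enters the half-space on one side
    only. *)
Lemma rel_nbhs_proper S x v : rel_nbhs S x ->
  ProperFilter (within [set h : R | S (x + h *: v)] (0^')).
Proof.
move=> Sx; apply: proper_within_dnbhs0 => d d0.
have near_line (Q : set 'rV[R]_n.+1) : nbhs x Q ->
    exists2 r : R, 0 < r < d & forall h, `|h| <= r -> Q (x + h *: v).
  move=> Qx.
  have Q0 : \forall h \near (0 : R), Q (x + h *: v).
    have c : x + h *: v @[h --> (0 : R)] --> x + 0 *: v.
      by apply: cvgD; [exact: cvg_cst | apply: cvgZr_tmp].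
    by rewrite scale0r addr0 in c; exact: c.
  move/nbhs_ballP: Q0 => [e /= e0 eQ].
  exists (Num.min d e / 2) => [|h hr].
    rewrite divr_gt0 ?lt_min ?d0//= (lt_le_trans (_ : _ < Num.min d e))//.
      by rewrite ltr_pdivrMr// ltr_pMr ?ltr1n// lt_min d0.
    by rewrite ge_min lexx.
  apply: eQ; rewrite -ball_normE /= sub0r normrN (le_lt_trans hr)//.
  rewrite (lt_le_trans (_ : _ < Num.min d e))//.
    by rewrite ltr_pdivrMr// ltr_pMr ?ltr1n// lt_min d0.
  by rewrite ge_min lexx orbT.
case: Sx => [Sx|[hx Sx]]; have [r /andP[r0 rd] rS] := near_line _ Sx.
  exists r; rewrite gt_eqF// gtr0_norm//; split=> //.
  by apply: rS; rewrite gtr0_norm.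
have [v0|v0] := leP 0 (v ord0 ord0).
  exists r; rewrite gt_eqF// gtr0_norm//; split=> //.
  apply: rS; first by rewrite gtr0_norm.
  by rewrite /half_space /= !mxE addr_ge0// mulr_ge0// ltW.
exists (- r); rewrite oppr_eq0 gt_eqF// normrN gtr0_norm//; split=> //.
apply: rS; first by rewrite normrN gtr0_norm.
by rewrite /half_space /= !mxE addr_ge0// mulr_le0// ?oppr_le0 ltW.
Qed.

(** On a half-space neighbourhood the identity [Q \o P = id] determines all
    directional derivatives, although it may fail on the other side. *)
Lemma diff_cancel S (P Q : 'rV[R]_n.+1 -> 'rV[R]_n.+1) x :
  rel_nbhs S x -> (forall y, S y -> Q (P y) = y) ->
  differentiable P x -> differentiable Q (P x) ->
  cancel ('d P x) ('d Q (P x)).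
Proof.
move=> Sx QP dP dQ v.
have Sxx := rel_nbhs_self Sx.
have PF := rel_nbhs_proper v Sx.
have E : dwithin S id x v = 'd (Q \o P) x v.
  apply: (dwithin_diff (O := setT)) => //; first exact: openT.
    by move=> y _ /QP.
  exact: differentiable_comp.
have E' : dwithin S id x v = v.
  have dI : differentiable (@id 'rV[R]_n.+1) x by [].
  rewrite (dwithin_diff PF openT I Sxx (fun _ _ _ => erefl) dI).
  by rewrite diff_val.
have C : 'd (Q \o P) x = 'd Q (P x) \o 'd P x :> (_ -> _).
  exact: diff_comp.
have Cv : 'd (Q \o P) x v = 'd Q (P x) ('d P x v) := congr1 (fun h => h v) C.
exact: etrans (esym Cv) (etrans (esym E) E').
Qed.

End relative.

Lemma smooth_on_subset (R : realType) (V W : normedModType R) (S S' : set V)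
    (f : V -> W) : S' `<=` S -> smooth_on S f -> smooth_on S' f.
Proof.
move=> sS sf x /sS /sf [Q [F [oQ Qx CF Ff]]]; exists Q, F; split=> // y Qy.
by move=> /sS; exact: Ff.
Qed.

Lemma smooth_on_ext (R : realType) (V W : normedModType R) (S : set V)
    (f g : V -> W) : (forall x, S x -> f x = g x) -> smooth_on S f ->
  smooth_on S g.
Proof.
move=> fg sf x Sx; have [Q [F [oQ Qx CF Ff]]] := sf x Sx.
by exists Q, F; split=> // y Qy Sy; rewrite Ff// fg.
Qed.

Lemma smooth_on_diff (R : realType) (n m : nat) (S : set 'rV[R]_n.+1)
    (f : 'rV[R]_n.+1 -> 'rV[R]_m) (x : 'rV[R]_n.+1) :
  smooth_on S f -> S x -> exists O F, [/\ open O, O x, forall k, C_on k O F,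
    forall y, O y -> S y -> F y = f y & forall y, O y -> differentiable F y].
Proof.
move=> sf Sx; have [Q [F [oQ Qx CF Ff]]] := sf x Sx.
exists Q, F; split=> // y Qy; exact: (C_on_differentiable_rV oQ (CF 1%N) Qy).
Qed.

(** Since [a < b], a point of [a, b] can be moved by small increments to the
    right or to the left. *)
Lemma proper_within_itv (R : realType) (a b s : R) (S : set R) :
  a < b -> s \in `[a, b] -> within [set` `[a, b]] (nbhs s) S ->
  ProperFilter (within [set h : R | (`[a, b]%classic `&` S) (s + h *: (1 : R))]
    (0^')).
Proof.
move=> ab; rewrite in_itv /= => /andP[as_ sb] /nbhs_ballP[r /= r0 rS].
apply: proper_within_dnbhs0 => d d0.
(* at most half of b - a, so that s + m or s - m lies in [a, b] *)
pose m := Num.min d (Num.min r (b - a)) / 2.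
have m0 : 0 < m by rewrite divr_gt0// !lt_min d0 r0 subr_gt0 ab.
have mlt : m < Num.min d (Num.min r (b - a)).
  by rewrite ltr_pdivrMr// ltr_pMr ?ltr1n// !lt_min d0 r0 subr_gt0 ab.
move: (mlt); rewrite !lt_min => /and3P[md mr mba].
have [sab|sab] := leP (s + m) b.
  exists m; rewrite gt_eqF// gtr0_norm//; split=> //=.
  have sm : s + m \in `[a, b] by rewrite in_itv /= sab andbT ler_wpDr// ltW.
  rewrite [_ *: 1]mulr1; split=> //; apply: rS => //.
  by rewrite /ball /= opprD addrA subrr sub0r normrN gtr0_norm.
exists (- m); rewrite oppr_eq0 gt_eqF// normrN gtr0_norm//; split=> //=.
have sm : s - m \in `[a, b].
  rewrite in_itv /=; apply/andP; split; last by rewrite lerBlDr ler_wpDr// ltW.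
  have mE : m + m <= b - a.
    by rewrite /m -splitr ge_min ge_min lexx !orbT.
  lra.
rewrite [_ *: 1]mulr1; split=> //; apply: rS => //.
by rewrite /ball /= opprB addrC subrK gtr0_norm.
Qed.

(** * Charts and curves in charts *)

Lemma open_within_cvg (T U : topologicalType) (S : set T) (f : T -> U) x :
  open S -> {within S, continuous f} -> S x -> {for x, continuous f}.
Proof.
move=> oS; rewrite continuous_open_subspace// => cf Sx.
by apply: cf; rewrite inE.
Qed.

Lemma within_cvg (T U : topologicalType) (S : set T) (f : T -> U) x :
  {within S, continuous f} -> S x -> f y @[y --> within S (nbhs x)] --> f x.
Proof. by move=> /subspace_continuousP; apply. Qed.

Lemma within_open_nbhs (T U : topologicalType) (S : set T) (f : T -> U) x
    (W : set U) : {within S, continuous f} -> S x -> nbhs (f x) W ->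
  exists O, [/\ open O, O x & forall y, O y -> S y -> W (f y)].
Proof.
move=> cf Sx Wx.
have : within S (nbhs x) (f @^-1` W) := within_cvg cf Sx Wx.
rewrite /within /= nbhsE => -[Q [oQ Qx] QW]; exists Q; split=> //.
Qed.

Section charts.
Variables (R : realType) (T : topologicalType) (n : nat) (c : chart R T n).
Hypothesis hc : is_chart c.

Let oc : open (chart_dom c). Proof. by case: hc. Qed.

Lemma chart_invK p : chart_dom c p -> chart_inv c (chart_map c p) = p.
Proof. by case: hc => _ _ + _ _; apply. Qed.

Lemma chart_continuous p : chart_dom c p -> {for p, continuous (chart_map c)}.
Proof. by case: hc => _ _ _ + _; exact: open_within_cvg. Qed.

Lemma chart_cod_rel_nbhs x : chart_cod c x -> rel_nbhs (chart_cod c) x.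
Proof.
move=> cx; case: hc => _ [oc1|[Q [oQ E]]] _ _ _.
  by left; exact: open_nbhs_nbhs.
move: cx; rewrite E => -[Qx hx]; right; split=> //.
have : nbhs x Q by exact: open_nbhs_nbhs.
by apply: filterS => y Qy hy.
Qed.

Lemma chart_rel_nbhs p W : chart_dom c p -> nbhs p W ->
  rel_nbhs (chart_map c @` (chart_dom c `&` W)) (chart_map c p).
Proof.
move=> dp Wp; set x := chart_map c p.
have cx : chart_cod c x by exists p.
have [_ _ _ _ ci] := hc.
have Wx : nbhs (chart_inv c x) W by rewrite chart_invK.
have [ O [oO Ox OW]] := within_open_nbhs ci cx Wx.
have := rel_nbhsI (chart_cod_rel_nbhs cx) (open_nbhs_nbhs (conj oO Ox)).
apply: rel_nbhsS => y [[q dq <-] Oy]; exists q => //; split=> //.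
by rewrite -(chart_invK dq); apply: OW => //; exists q.
Qed.

Lemma coord_dom_rel_nbhs (T' : topologicalType) (c' : chart R T' n) F p :
  open (F @^-1` chart_dom c') -> chart_dom c p -> chart_dom c' (F p) ->
  rel_nbhs (coord_dom c c' setT F) (chart_map c p).
Proof.
move=> oF dp dFp; rewrite /coord_dom setTI.
by apply: chart_rel_nbhs => //; exact: open_nbhs_nbhs.
Qed.

Lemma coord_mapE (T' : Type) (c' : chart R T' n) F p : chart_dom c p ->
  coord_map c c' F (chart_map c p) = chart_map c' (F p).
Proof. by move=> dp; rewrite /coord_map chart_invK. Qed.

End charts.

Section manifold.
Variables (R : realType) (T : topologicalType) (n : nat).
Variable A : set (chart R T n).
Hypothesis hA : smooth_manifold A.

Lemma manifold_chart c : A c -> is_chart c.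
Proof. by case: hA => _ _ + _ _; apply. Qed.

Lemma manifold_chart_open c : A c -> open (chart_dom c).
Proof. by move=> /manifold_chart[]. Qed.

Lemma manifold_cover p : exists2 c, A c & chart_dom c p.
Proof. by case: hA => _ _ _ + _; apply. Qed.

Lemma manifold_transition c c' : A c -> A c' ->
  smooth_on (coord_dom c c' setT id) (coord_map c c' id).
Proof. by case: hA => _ _ _ _; apply. Qed.

End manifold.

(** The curve is required to stay in the chart at all times of [O] in [a, b], so
    that its velocity at any of them is the derivative of [Gam]. *)
Definition local_rep (R : realType) (T : topologicalType) (n : nat)
    (c : chart R T n) (a b : R) (gam : R -> T) (s : R) (O : set R)
    (Gam : R -> 'rV[R]_n.+1) : Prop :=
  [/\ open O, O s, forall k, C_on k O Gam & forall t, O t -> t \in `[a, b] ->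
      chart_dom c (gam t) /\ Gam t = chart_map c (gam t)].

Section curves.
Variables (R : realType) (T : topologicalType) (n : nat).
Implicit Types (c : chart R T n) (a b s : R).

Lemma local_repP c a b gam s :
  open (chart_dom c) -> {within `[a, b], continuous gam} ->
  smooth_on (curve_dom c a b gam) (curve_coord c gam) ->
  s \in `[a, b] -> chart_dom c (gam s) ->
  exists O Gam, local_rep c a b gam s O Gam.
Proof.
move=> oc cg sg sab ds.
have [ O [F [oO Os CF Ff]]] := sg s (conj sab ds).
have [ O' [oO' Os' Od]] := within_open_nbhs cg sab
  (open_nbhs_nbhs (conj oc ds)).
exists (O `&` O'), F; split=> //.
- exact: openI.
- by move=> k; apply: C_on_subset (CF k) => t [].
move=> t [Ot Ot'] tab; have dt := Od t Ot' tab; split=> //.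
by rewrite Ff.
Qed.

Lemma velocity_rep c a b gam s O Gam t : a < b ->
  local_rep c a b gam s O Gam -> O t -> t \in `[a, b] ->
  velocity c a b gam t = 'D_1 Gam t.
Proof.
move=> ab [oO Os CG GE] Ot tab; rewrite /velocity.
have [dt Gt] := GE t Ot tab.
have dG : differentiable Gam t.
  by apply/derivable1_diffP; exact: C_on_derivable (CG 1%N) Ot.
rewrite (deriveE _ dG).
apply: (dwithin_diff (O := O)) => //; last first.
  by move=> u Ou [uab du]; have [] := GE u Ou uab.
apply: proper_within_itv => //.
have : nbhs t O by exact: open_nbhs_nbhs.
by apply: filterS => u Ou uab; have [] := GE u Ou uab.
Qed.

End curves.

(** Coordinate expressions live on relatively open sets, where [dwithin] is
    the differential of any local extension. *)
Lemma pullback_diff (R : realType) (T T' : topologicalType) (n : nat)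
    (A : set (chart R T n)) (A' : set (chart R T' n)) F g' g c c' p O f v w :
  is_pullback A A' F g' g -> A c -> A' c' -> is_chart c ->
  open (F @^-1` chart_dom c') -> chart_dom c p -> chart_dom c' (F p) ->
  open O -> O (chart_map c p) ->
  (forall y, O y -> coord_dom c c' setT F y -> f y = coord_map c c' F y) ->
  differentiable f (chart_map c p) ->
  bilin (g c (chart_map c p)) v w =
  bilin (g' c' (chart_map c' (F p))) ('d f (chart_map c p) v)
    ('d f (chart_map c p) w).
Proof.
move=> pb Ac Ac' hc oF dp dFp oO Ox ff df; set x := chart_map c p.
have xD : rel_nbhs (coord_dom c c' setT F) x by exact: coord_dom_rel_nbhs.
have Dx := rel_nbhs_self xD.
rewrite (pb c c' Ac Ac' x Dx) coord_mapE//.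
by rewrite !(dwithin_diff (rel_nbhs_proper _ xD) oO Ox Dx ff df).
Qed.

Lemma open_setI_preimage (T U : topologicalType) (O : set T) (Q : set U)
    (f : T -> U) :
  open O -> open Q -> (forall x, O x -> {for x, continuous f}) ->
  open (O `&` f @^-1` Q).
Proof.
move=> oO oQ cf; rewrite openE => x [Ox Qx]; apply: filterI.
  exact: open_nbhs_nbhs.
by apply: (cf x Ox); exact: open_nbhs_nbhs.
Qed.

(** The chain rule carries a smooth representative of the curve in one chart
    to one in any chart of the target, and the pullback relation carries the
    speed. With [F := id] the lemma says that smoothness and speed can be
    tested in one chart around each time; this is how straight segments are
    treated. *)
Lemma pushforward_curve (R : realType) (T T' : topologicalType) (n : nat)
    (A : set (chart R T n)) (A' : set (chart R T' n)) (F : T -> T')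
    (g' : tensor_field R T' n) (g : tensor_field R T n) (a b : R)
    (gam : R -> T) (v : R -> R) :
  a < b -> (forall c, A c -> is_chart c) ->
  (forall c', A' c' -> open (F @^-1` chart_dom c')) ->
  (forall c c', A c -> A' c' ->
     smooth_on (coord_dom c c' setT F) (coord_map c c' F)) ->
  is_pullback A A' F g' g ->
  continuous F -> {within `[a, b], continuous gam} ->
  (forall s, s \in `[a, b] -> exists c O Gam,
     [/\ A c, local_rep c a b gam s O Gam &
      v s = Num.sqrt (bilin (g c (curve_coord c gam s))
                      ('D_1 Gam s) ('D_1 Gam s))]) ->
  smooth_curve A' a b (F \o gam) /\ is_speed A' g' a b (F \o gam) v.
Proof.
move=> ab hA oF sF pb cF cg rep.
have main c' s : A' c' -> s \in `[a, b] -> chart_dom c' (F (gam s)) ->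
    exists O G, local_rep c' a b (F \o gam) s O G /\
      v s = Num.sqrt (bilin (g' c' (chart_map c' (F (gam s))))
          ('D_1 G s) ('D_1 G s)).
  move=> Ac' sab dFs.
  have [c [ O [Gam [Ac [oO Os CG GE] vE]]]] := rep s sab.
  have [ds Gs] := GE s Os sab.
  have hc := hA c Ac.
  have xD : rel_nbhs (coord_dom c c' setT F) (chart_map c (gam s)).
    by apply: coord_dom_rel_nbhs => //; exact: oF.
  have [Q [f [oQ Qx Cf fE df]]] := smooth_on_diff (sF c c' Ac Ac')
    (rel_nbhs_self xD).
  have [ O1 [oO1 O1s O1d]] := within_open_nbhs cg sab
    (open_nbhs_nbhs (conj (oF c' Ac') dFs)).
  have dGam t : O t -> differentiable Gam t.
    by move=> Ot; apply/derivable1_diffP; exact: C_on_derivable (CG 1%N) Ot.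
  have cGam t : O t -> {for t, continuous Gam}.
    by move=> Ot; exact: C_on_continuous (CG 0%N) Ot.
  exists ((O `&` Gam @^-1` Q) `&` O1), (f \o Gam); split; first split.
  - by apply: openI => //; exact: open_setI_preimage.
  - by split=> //; split=> //=; rewrite Gs.
  - move=> k; apply: (C_on_comp_rV (Q := Q)) => //.
    + by apply: openI => //; exact: open_setI_preimage.
    + by move=> t [[]].
    + by move=> l; apply: C_on_subset (CG l) => t [[]].
  - move=> t [[Ot Qt] O1t] tab; have dFt := O1d t O1t tab; split=> //.
    have [dt Gt] := GE t Ot tab.
    rewrite /= fE//; first by rewrite Gt coord_mapE.
    by rewrite Gt; exists (gam t) => //; split=> //; split.
  have dfx : differentiable f (Gam s) by apply: df; rewrite Gs.
  have [_ ->] := @is_derive_diff_comp _ _ _ _ Gam f s 1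
    (C_on_derivable (CG 1%N) Os) (cGam s Os) dfx.
  rewrite vE /curve_coord.
  have dfx' : differentiable f (chart_map c (gam s)) by rewrite -Gs.
  rewrite (pullback_diff _ _ pb Ac Ac' hc (oF c' Ac') ds dFs oQ Qx fE dfx').
  by rewrite Gs.
split; first split.
- apply/subspace_continuousP => x xab.
  exact: cvg_comp (within_cvg cg xab) (cF (gam x)).
- move=> c' Ac' s [sab dFs].
  have [ O [G [[oO Os CG GE] _]]] := main c' s Ac' sab dFs.
  by exists O, G; split=> // t Ot [tab dt]; have [_ ->] := GE t Ot tab.
move=> c' s Ac' [sab dFs]; have [ O [G [lr ->]]] := main c' s Ac' sab dFs.
have [_ Os _ _] := lr.
by rewrite (velocity_rep ab lr Os sab).
Qed.

(** * Speed and length of curves *)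

Lemma mulmx_cvg (R : realType) (T : Type) (F : set_system T) {FF : Filter F}
    (m n p : nat) (f : T -> 'M[R]_(m, n)) (h : T -> 'M[R]_(n, p))
    (A : 'M[R]_(m, n)) (B : 'M[R]_(n, p)) :
  f t @[t --> F] --> A -> h t @[t --> F] --> B ->
  f t *m h t @[t --> F] --> A *m B.
Proof.
move=> fA hB; apply: mx_cvg => i j; rewrite mxE.
under eq_cvg do rewrite mxE.
apply: cvg_big => [|k _]; first exact: add_continuous.
by apply: cvgM; apply: coord_cvg.
Qed.

Lemma bilin_cvg (R : realType) (T : Type) (F : set_system T) {FF : Filter F}
    (n : nat) (B : T -> 'M[R]_n.+1) (v w : T -> 'rV[R]_n.+1)
    (B0 : 'M[R]_n.+1) (v0 w0 : 'rV[R]_n.+1) :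
  B t @[t --> F] --> B0 -> v t @[t --> F] --> v0 -> w t @[t --> F] --> w0 ->
  bilin (B t) (v t) (w t) @[t --> F] --> bilin B0 v0 w0.
Proof.
move=> BB vv ww; apply: coord_cvg; apply: mulmx_cvg; first exact: mulmx_cvg.
apply: mx_cvg => i j; rewrite mxE; under eq_cvg do rewrite mxE.
exact: coord_cvg.
Qed.

Lemma bilinZ (R : realType) (n : nat) (B : 'M[R]_n.+1) a (v : 'rV[R]_n.+1) :
  bilin B (a *: v) (a *: v) = a ^+ 2 * bilin B v v.
Proof.
by rewrite /bilin linearZ /= -scalemxAr -scalemxAl -scalemxAl scalerA mxE.
Qed.

Lemma sqrt_bilinZ (R : realType) (n : nat) (B : 'M[R]_n.+1) a
    (v : 'rV[R]_n.+1) :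
  Num.sqrt (bilin B (a *: v) (a *: v)) = `|a| * Num.sqrt (bilin B v v).
Proof. by rewrite bilinZ sqrtrM ?sqr_ge0// sqrtr_sqr. Qed.

Lemma bilin_le (R : realType) (n : nat) (B : 'M[R]_n.+1) (v : 'rV[R]_n.+1) e :
  (forall i j, `|B i j| <= e) ->
  `|bilin B v v| <= (n.+1%:R ^+ 2 * e) * `|v| ^+ 2.
Proof.
move=> Be; rewrite /bilin mxE.
apply: (le_trans (ler_norm_sum _ _ _)).
apply: (@le_trans _ _ (\sum_(j < n.+1) (n.+1%:R * e) * `|v| ^+ 2)); last first.
  by rewrite sumr_const card_ord -[leLHS]mulr_natl !mulrA -expr2.
apply: ler_sum => j _; rewrite !mxE normrM expr2 mulrA.
apply: ler_pM => //; last exact: rV_coord_le.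
apply: (le_trans (ler_norm_sum _ _ _)).
apply: (@le_trans _ _ (\sum_(i < n.+1) e * `|v|)); last first.
  by rewrite sumr_const card_ord -[leLHS]mulr_natl mulrA.
apply: ler_sum => i _; rewrite normrM mulrC.
by apply: ler_pM => //; exact: rV_coord_le.
Qed.

(** Subadditivity of the square root; negative numbers have square root 0. *)
Lemma sqrt_le_add (R : realType) (x y : R) :
  Num.sqrt x <= Num.sqrt y + Num.sqrt `|x - y|.
Proof.
have s0 := addr_ge0 (sqrtr_ge0 y) (sqrtr_ge0 `|x - y|).
have [x0|/ltW x0] := leP 0 x; last first.
  by rewrite (eqP (_ : Num.sqrt x == 0)) ?sqrtr_eq0.
rewrite -(ler_pXn2r (n := 2))// ?nnegrE ?sqrtr_ge0//.
rewrite sqr_sqrtr// sqrrD (sqr_sqrtr (normr_ge0 _)).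
have [y0|y0] := leP 0 y.
  rewrite sqr_sqrtr// addrAC (le_trans (_ : _ <= y + `|x - y|))//.
    by rewrite -lerBlDl ler_norm.
  by rewrite lerDl mulrn_wge0// mulr_ge0// sqrtr_ge0.
rewrite (eqP (_ : Num.sqrt y == 0)) ?sqrtr_eq0 ?(ltW y0)//.
rewrite expr0n /= mul0r mul0rn !add0r (le_trans _ (ler_norm _))//.
by rewrite lerBrDl gerDr ltW.
Qed.

Section speed.
Variables (R : realType) (T : topologicalType) (n : nat).
Variables (A : set (chart R T n)) (g : tensor_field R T n).
Hypothesis oA : forall c, A c -> open (chart_dom c).
Hypothesis covA : forall p, exists2 c, A c & chart_dom c p.
Hypothesis hg : riemannian_metric A g.

Lemma speed_continuous (a b : R) gam (v : R -> R) : a < b ->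
  smooth_curve A a b gam -> is_speed A g a b gam v ->
  {within `[a, b], continuous v}.
Proof.
move=> ab [cg sg] vE; apply/subspace_continuousP => s sab.
have [c Ac ds] := covA (gam s).
have [ O [Gam lr]] := local_repP (oA Ac) cg (sg c Ac) sab ds.
have [oO Os CG GE] := lr.
have [_ Gs] := GE s Os sab.
have [sgc _] := hg.2 c Ac.
have xc : chart_cod c (Gam s) by rewrite Gs; exists (gam s).
have [Q [B [oQ Qx CB BE]]] := sgc _ xc.
pose H := within [set` `[a, b]] (nbhs s).
have HF : Filter H by exact: within_filter.
have toH (W : topologicalType) (f : R -> W) : {for s, continuous f} ->
    f t @[t --> H] --> f s.
  by move=> cf; apply: cvg_trans cf; apply: cvg_app; exact: cvg_within.
have cG : Gam t @[t --> H] --> Gam s.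
  by apply: toH; exact: C_on_continuous (CG 0%N) Os.
have vs : v s = Num.sqrt (bilin (B (Gam s)) ('D_1 Gam s) ('D_1 Gam s)).
  have BG : B (Gam s) = g c (Gam s) by exact: BE.
  have VR := velocity_rep ab lr Os sab.
  have CE : curve_coord c gam s = Gam s := esym Gs.
  have vt := vE c s Ac (conj sab ds).
  by rewrite CE VR -BG in vt; exact: vt.
suff : v t @[t --> H] -->
    Num.sqrt (bilin (B (Gam s)) ('D_1 Gam s) ('D_1 Gam s)).
  by rewrite -vs.
apply: (cvg_near_eq (f := fun t =>
    Num.sqrt (bilin (B (Gam t)) ('D_1 Gam t) ('D_1 Gam t)))).
  have nO : \forall t \near H, O t.
    by apply: cvg_within; exact: open_nbhs_nbhs.
  have nab : \forall t \near H, t \in `[a, b].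
    by rewrite /H near_withinE; exact: filterE.
  have nQ : \forall t \near H, Q (Gam t) by apply: cG; exact: open_nbhs_nbhs.
  near=> t.
  have Ot : O t by near: t.
  have tab : t \in `[a, b] by near: t.
  have [dt Gt] := GE t Ot tab.
  have QG : Q (Gam t) by near: t.
  have BG : B (Gam t) = g c (Gam t).
    by apply: BE => //; rewrite Gt; exists (gam t).
  have VR := velocity_rep ab lr Ot tab.
  have CE : curve_coord c gam t = Gam t := esym Gt.
  have vt := vE c t Ac (conj tab dt).
  rewrite CE VR -BG in vt; exact: vt.
apply: (cvg_comp _ Num.sqrt _ (@sqrt_continuous R _)).
have cD : 'D_1 Gam t @[t --> H] --> 'D_1 Gam s.
  have CD : C_on 0 O ('D_1 Gam) by apply: C_on_derive.
  have cD : {for s, continuous ('D_1 Gam)} := C_on_continuous CD Os.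
  exact: toH cD.
apply: bilin_cvg => //.
exact: (cvg_comp Gam B cG (C_on_continuous (CB 0%N) Qx)).
Unshelve. all: by end_near. Qed.

Lemma speed_measurable (a b : R) gam (v : R -> R) : a < b ->
  smooth_curve A a b gam -> is_speed A g a b gam v ->
  measurable_fun `[a, b] v.
Proof.
move=> ab sg vE.
apply: measurable_realfun.subspace_continuous_measurable_fun => //.
exact: speed_continuous vE.
Qed.

End speed.

Section dist.
Variables (R : realType) (T : topologicalType) (n : nat).
Variables (A : set (chart R T n)) (g : tensor_field R T n).
Local Notation d := (riemannian_dist A g).
Local Open Scope ereal_scope.

Lemma dist_refl p : d p p <= 0.
Proof. by apply: ereal_inf_lbound; exact: PwNil. Qed.

Lemma piecewise_curve_concat p q r l l' :
  piecewise_curve A g q p l -> piecewise_curve A g r q l' ->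
  piecewise_curve A g r p (l + l').
Proof.
move=> + h; elim=> [|a b gam v m ab sg vE pw IH]; first by rewrite add0e.
by rewrite -addeA; exact: PwCons.
Qed.

(** Strict bounds are witnessed by curves, and curves can be concatenated. *)
Lemma dist_triangle_lt p q r x y : d p q < x -> d q r < y -> d p r < x + y.
Proof.
move=> /ereal_inf_lt[l pl lx] /ereal_inf_lt[l' pl' ly].
apply: le_lt_trans (lteD lx ly); apply: ereal_inf_lbound.
exact: piecewise_curve_concat pl'.
Qed.

Lemma dist_curve a b gam v : (a < b)%R -> smooth_curve A a b gam ->
  is_speed A g a b gam v ->
  d (gam a) (gam b) <= \int[lebesgue_measure]_(s in `[a, b]) (v s)%:E.
Proof.
move=> ab sg vE; have := PwCons ab sg vE (PwNil A g _).
by rewrite adde0; exact: ereal_inf_lbound.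
Qed.

End dist.

(** * Comparison of the distance with the metric in a chart *)

Section line.
Variables (R : realType) (V : normedModType R) (y w : V).
Let line (t : R) : V := y + t *: w.

Lemma is_derive_affine (x v : R) : is_derive x v line (v *: w).
Proof.
have Q : h^-1 *: (line (h *: v + x) - line x) @[h --> 0^'] --> v *: w.
  apply: cvg_near_eq (cvg_cst (v *: w)).
  near=> h; rewrite /line opprD addrACA subrr add0r -scalerBl addrK scalerA.
  rewrite mulrA mulVf ?mul1r//; near: h; exact: nbhs_dnbhs_neq.
by apply: DeriveDef; [apply/cvg_ex; eexists; exact: Q | apply/cvg_lim].
Unshelve. all: by end_near. Qed.

Lemma C_on_line k : C_on k setT line.
Proof.
have cl x : {for x, continuous line}.
  apply: differentiable_continuous; apply/derivable1_diffP.
  by have [] := is_derive_affine x 1.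
case: k => [|k]; split=> // v; split=> [x _|].
  by have [] := is_derive_affine x v.
apply: (C_on_ext openT _ (C_on_cst k (v *: w) openT)) => x _.
by have [_ ->] := is_derive_affine x v.
Qed.

End line.

Section local.
Variables (R : realType) (T : topologicalType) (n : nat).
Variables (A : set (chart R T n)) (g : tensor_field R T n).
Hypothesis hA : smooth_manifold A.
Hypothesis hg : riemannian_metric A g.
Local Notation d := (riemannian_dist A g).

Let cA c (Ac : A c) : is_chart c := manifold_chart hA Ac.
Let oA c (Ac : A c) : open (chart_dom c) := manifold_chart_open hA Ac.
Let covA p : exists2 c, A c & chart_dom c p := manifold_cover hA p.

Lemma dist_segment c (y z : 'rV[R]_n.+1) (K : R) : A c ->
  (forall t : R, t \in `[0, 1] -> chart_cod c (y + t *: (z - y))) ->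
  (forall t : R, t \in `[0, 1] ->
     Num.sqrt (bilin (g c (y + t *: (z - y))) (z - y) (z - y)) <= K) ->
  (d (chart_inv c y) (chart_inv c z) <= K%:E)%E.
Proof.
move=> Ac cod le_K; set w := z - y in cod le_K.
pose line (t : R) := y + t *: w.
pose gam (t : R) := chart_inv c (line t).
have cline : continuous line.
  by move=> t; exact: C_on_continuous (C_on_line y w 0%N) I.
have hc := cA Ac; have [_ _ cK _ ci] := hc.
have domc t : t \in `[0, 1] -> chart_dom c (gam t).
  move=> tab; rewrite /gam.
  by have [q dq <-] : chart_cod c (line t) := cod t tab; rewrite cK.
have cg : {within `[0, 1], continuous gam}.
  apply/subspace_continuousP => t tab W Wt.
  have [ O [oO Ot OW]] := within_open_nbhs ci (cod t tab) Wt.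
  have : nbhs t (line @^-1` O) by apply: cline; exact: open_nbhs_nbhs.
  by apply: filterS => u Ou uab; apply: OW => //; exact: cod.
pose v t := Num.sqrt (bilin (g c (line t)) w w).
have [sg sp] : smooth_curve A 0 1 gam /\ is_speed A g 0 1 gam v.
  apply: (pushforward_curve (F := id) (A := A) (g := g)) => //.
  - by case: hA.
  - by case: hg.
  - by move=> x.
  move=> s sab; exists c, setT, line; split=> //.
    split=> //; first exact: openT.
      by move=> k; exact: C_on_line.
    move=> t _ tab; split; first exact: domc.
    rewrite /gam.
    by have [q dq <-] : chart_cod c (line t) := cod t tab; rewrite cK.
  have [_ ->] := is_derive_affine y w s 1; rewrite scale1r /v /curve_coord.
  rewrite /gam.
  by have [q dq <-] : chart_cod c (line s) := cod s sab; rewrite cK.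
have -> : chart_inv c y = gam 0 by rewrite /gam /line scale0r addr0.
have -> : chart_inv c z = gam 1 by rewrite /gam /line scale1r addrC subrK.
apply: (le_trans (dist_curve ltr01 sg sp)).
have -> : K%:E = (\int[lebesgue_measure]_(t in `[0%R, 1%R]) (cst K%:E t))%E.
  rewrite integral_cst//= lebesgue_measure_itv /= lte_fin ltr01.
  by rewrite sube0 mule1.
apply: ge0_le_integral => //.
- by move=> t _; rewrite lee_fin sqrtr_ge0.
- by apply/measurable_realfun.measurable_EFinP; exact: speed_measurable sp.
Qed.

(** The image of a chart is locally a ball or a ball cut by the half-space;
    both are convex. *)
Lemma chart_cod_star (c : chart R T n) x : is_chart c -> chart_cod c x ->
  exists2 r : R, 0 < r & forall y z t s, chart_cod c y -> chart_cod c z ->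
    t \in `[(0 : R), 1] -> s <= r -> `|y - x| < s -> `|z - x| < s ->
    chart_cod c (y + t *: (z - y)) /\ `|y + t *: (z - y) - x| < s.
Proof.
move=> hc cx.
have seg (r : R) (y z : 'rV[R]_n.+1) t : t \in `[(0 : R), 1] ->
    `|y - x| < r -> `|z - x| < r -> `|y + t *: (z - y) - x| < r.
  rewrite in_itv /= => /andP[t0 t1] yr zr.
  have -> : y + t *: (z - y) - x = (1 - t) *: (y - x) + t *: (z - x).
    by apply/rowP => i; rewrite !mxE; ring.
  apply: (le_lt_trans (ler_normD _ _)); rewrite !normrZ ger0_norm ?subr_ge0//.
  rewrite (ger0_norm t0).
  have [->|t0'] := eqVneq t 0; first by rewrite subr0 mul1r mul0r addr0.
  have : t * `|z - x| < t * r by rewrite ltr_pM2l// lt0r t0' t0.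
  have : (1 - t) * `|y - x| <= (1 - t) * r.
    by rewrite ler_wpM2l ?subr_ge0// ltW.
  by move=> h1 h2; lra.
have ballE (Q : set 'rV[R]_n.+1) : open Q -> Q x ->
    exists2 r : R, 0 < r & forall y, `|y - x| < r -> Q y.
  move=> oQ Qx.
  have /nbhs_ballP[r /= r0 rQ] : nbhs x Q by exact: open_nbhs_nbhs.
  by exists r => // y yr; apply: rQ; rewrite -ball_normE /= distrC.
case: hc => _ [oQ|[Q [oQ E]]] _ _ _.
  have [r r0 rQ] := ballE _ oQ cx; exists r => // y z t s _ _ t01 sr yr zr.
  by have ls := seg _ _ _ _ t01 yr zr; split=> //; apply/rQ/(lt_le_trans ls).
move: cx; rewrite E => -[Qx _].
have [r r0 rQ] := ballE _ oQ Qx.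
exists r => // y z t s [_ hy] [_ hz] t01 sr yr zr.
have ls := seg _ _ _ _ t01 yr zr; split=> //.
split; first by apply/rQ/(lt_le_trans ls).
move: t01; rewrite in_itv /= => /andP[t0 t1]; rewrite /half_space /= !mxE.
have -> : y ord0 ord0 + t * (z ord0 ord0 - y ord0 ord0) =
  (1 - t) * y ord0 ord0 + t * z ord0 ord0 by ring.
by rewrite addr_ge0// mulr_ge0// subr_ge0.
Qed.

Lemma metric_near c x e : A c -> chart_cod c x -> 0 < e ->
  exists2 r : R, 0 < r & forall y w, chart_cod c y -> `|y - x| < r ->
    Num.sqrt (bilin (g c y) w w) <= Num.sqrt (bilin (g c x) w w) + e * `|w|.
Proof.
move=> Ac cx e0.
have [sg _] := hg.2 c Ac.
have [Q [B [oQ Qx CB BE]]] := sg x cx.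
pose N : R := n.+1%:R.
have N0 : 0 < N by rewrite ltr0n.
(* [bilin_le] and a square root turn [eta] into e *)
pose eta := (e / N) ^+ 2.
have eta0 : 0 < eta by rewrite exprn_gt0// divr_gt0.
have cB : {for x, continuous B} := C_on_continuous (CB 0%N) Qx.
have QB : \forall y \near x, Q y /\ `|B x - B y| < eta.
  apply: filterI; first exact: open_nbhs_nbhs.
  by have /cvgrPdist_lt/(_ _ eta0) := cB.
have /nbhs_ballP[r /= r0 rQ] := QB; exists r => // y w cy yr.
have [Qy By] : Q y /\ `|B x - B y| < eta.
  by apply: rQ; rewrite -ball_normE /= distrC.
apply: (le_trans (sqrt_le_add _ (bilin (g c x) w w))); rewrite lerD2l.
have -> : bilin (g c y) w w - bilin (g c x) w w = bilin (B y - B x) w w.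
  by rewrite !BE// /bilin mulmxBr mulmxBl !mxE.
rewrite -(ler_pXn2r (n := 2)) ?nnegrE ?sqrtr_ge0 ?mulr_ge0 ?(ltW e0)//.
rewrite sqr_sqrtr//.
have Be : forall i j, `|(B y - B x) i j| <= eta.
  move=> i j; apply: le_trans (ltW By); rewrite -normrN opprB.
  rewrite [leRHS]/Num.Def.normr /= mx_normrE.
  exact: (le_bigmax _ (fun ij => `|(B y - B x) ij.1 ij.2|) (i, j)).
apply: (le_trans (bilin_le w Be)); rewrite exprMn ler_wpM2r ?sqr_ge0//.
by rewrite /eta expr_div_n mulrCA divff ?mulr1// sqrf_eq0 gt_eqF.
Qed.

(** The distance is an infimum over oriented curves, so the segment is run in
    both directions. *)
Lemma dist_chart_le c p e : A c -> chart_dom c p -> 0 < e ->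
  exists2 r : R, 0 < r & forall q, chart_dom c q ->
    let w := chart_map c q - chart_map c p in `|w| < r ->
    let K := Num.sqrt (bilin (g c (chart_map c p)) w w) + e * `|w| in
    (d p q <= K%:E)%E /\ (d q p <= K%:E)%E.
Proof.
move=> Ac dp e0; set x := chart_map c p.
have hc := cA Ac.
have cx : chart_cod c x by exists p.
have [r1 r10 star] := chart_cod_star hc cx.
have [r2 r20 near_g] := metric_near Ac cx e0.
have [r r0 [rr1 rr2]] : exists2 r : R, 0 < r & r <= r1 /\ r <= r2.
  by exists (Num.min r1 r2); rewrite ?lt_min ?r10 ?ge_min ?lexx ?orbT.
exists r => // q dq w wr K.
have cq : chart_cod c (chart_map c q) by exists q.
have xr : `|x - x| < r by rewrite subrr normr0.
have near_le y : chart_cod c y /\ `|y - x| < r ->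
    Num.sqrt (bilin (g c y) w w) <= K.
  by move=> [cy yr]; apply: near_g => //; exact: lt_le_trans rr2.
have bilinN B : bilin B (x - chart_map c q) (x - chart_map c q) = bilin B w w.
  by rewrite -(opprB _ x) -/w -scaleN1r bilinZ sqrrN expr1n mul1r.
rewrite -(chart_invK hc dp) -(chart_invK hc dq); split.
  apply: dist_segment => // t t01.
    by have [] := star x _ t r cx cq t01 rr1.
  by apply: near_le; exact: star.
apply: dist_segment => // t t01.
  by have [] := star _ x t r cq cx t01 rr1 wr xr.
by rewrite bilinN; apply: near_le; apply: star.
Qed.

End local.

(** * Invariance of the boundary *)

Lemma chart_nbhs (R : realType) (T : topologicalType) (n : nat)
    (c : chart R T n) p W : is_chart c -> chart_dom c p ->
  nbhs (chart_map c p) (chart_cod c) -> nbhs p W ->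
  nbhs (chart_map c p) (chart_map c @` (chart_dom c `&` W)).
Proof.
move=> hc dp cn Wp; set x := chart_map c p.
have cx : chart_cod c x by exists p.
have [_ _ _ _ ci] := hc.
have Wx : nbhs (chart_inv c x) W by rewrite chart_invK.
have [ O' [oO Ox OW]] := within_open_nbhs ci cx Wx.
apply: filterS (filterI cn (open_nbhs_nbhs (conj oO Ox))).
move=> y [[q dq <-] Oy]; exists q => //; split=> //.
by rewrite -(chart_invK hc dq); apply: OW => //; exists q.
Qed.

Lemma half_space_nbhs (R : realType) (n : nat) (x : 'rV[R]_n.+1) :
  0 < x ord0 ord0 -> nbhs x (@half_space R n).
Proof.
move=> x0.
have cx : y ord0 ord0 @[y --> x] --> x ord0 ord0.
  exact: (@coord_continuous R 1 n.+1 ord0 ord0).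
exact: (@filterS _ (nbhs x) (nbhs_filter x) _ _
  (fun y hy => ltW hy) (cvgr_gt _ cx _ x0)).
Qed.

Section boundary.
Variables (R : realType) (T : topologicalType) (n : nat).
Variable A : set (chart R T n).
Hypothesis hA : smooth_manifold A.

Let cA c (Ac : A c) : is_chart c := manifold_chart hA Ac.
Let oA c (Ac : A c) : open (chart_dom c) := manifold_chart_open hA Ac.
Let covA p : exists2 c, A c & chart_dom c p := manifold_cover hA p.
Let smA c c' (Ac : A c) (Ac' : A c') :
  smooth_on (coord_dom c c' setT id) (coord_map c c' id) :=
  manifold_transition hA Ac Ac'.

(** Otherwise the transition map from [c] to [c'], defined around an interior
    point, would have an invertible differential there, and its first
    coordinate, which is nonnegative and vanishes at the point, would take
    negative values. *)
Lemma boundary_not_interior c c' p : A c -> A c' ->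
  chart_dom c p -> chart_dom c' p -> open_in_half_space (chart_cod c') ->
  chart_map c' p ord0 ord0 = 0 -> ~ nbhs (chart_map c p) (chart_cod c).
Proof.
move=> Ac Ac' dp dp' [K [oK KE]] p0 cn.
set x := chart_map c p.
pose D := coord_dom c c' setT (@id T).
pose D' := coord_dom c' c setT (@id T).
have Dx : nbhs x D.
  rewrite /D /coord_dom setTI; apply: chart_nbhs => //; first exact: cA.
  by apply: open_nbhs_nbhs; split=> //; exact: oA.
have Dx' : D' (chart_map c' p) by exists p.
have [Q [f [oQ Qx Cf fE df]]] :=
  smooth_on_diff (smA Ac Ac') (nbhs_singleton Dx).
have [Q' [f' [oQ' Qx' Cf' fE' df']]] := smooth_on_diff (smA Ac' Ac) Dx'.
have fx : f x = chart_map c' p.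
  by rewrite fE ?(coord_mapE (cA Ac))//; exact: nbhs_singleton.
have cf : forall y, Q y -> {for y, continuous f}.
  by move=> y Qy; exact: C_on_continuous (Cf 0%N) Qy.
pose O := Q `&` f @^-1` Q'.
have oO : open O by exact: open_setI_preimage.
have Ox : O x by split=> //; rewrite /= fx.
have fK : forall y, (D `&` O) y -> f' (f y) = y.
  move=> y [Dy [Qy Q'y]]; have := Q'y; rewrite /= fE//.
  have [q [[_ dq] dq'] <-] := Dy.
  rewrite (coord_mapE (cA Ac))// => Q'q; rewrite fE'//; last by exists q.
  by rewrite (coord_mapE (cA Ac')).
have SO : nbhs x (D `&` O).
  by apply: filterI => //; exact: open_nbhs_nbhs.
have dfx : differentiable f x by exact: df.
have dfx' : differentiable f' (f x) by apply: df'; rewrite fx.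
have Dfx := diff_cancel (or_introl SO) fK dfx dfx'.
pose e0 : 'rV[R]_n.+1 := delta_mx ord0 ord0.
(* along v the first coordinate of the transition map has derivative 1 *)
pose v := 'd f' (f x) e0.
have Dv : 'd f x v = e0 := linear_left_inverse Dfx e0.
have q : h^-1 *: (f (h *: v + x) - f x) @[h --> (0 : R)^'] --> e0.
  by rewrite -Dv -deriveE//; exact: (diff_derivable dfx).
have q0 : (h^-1 *: (f (h *: v + x) - f x)) ord0 ord0
    @[h --> (0 : R)^'] --> (1 : R).
  have -> : 1 = e0 ord0 ord0 by rewrite /e0 mxE eqxx.
  exact: coord_cvg.
have pos : \forall h \near (0 : R)^',
    0 < (h^-1 *: (f (h *: v + x) - f x)) ord0 ord0.
  exact: (cvgr_gt _ q0 _ ltr01).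
have inD : \forall h \near (0 : R)^', (D `&` Q) (h *: v + x).
  have xDQ : nbhs x (D `&` Q) by apply: filterI => //; exact: open_nbhs_nbhs.
  exact: (@cvg_line R _ x v _ xDQ).
have [r /= r0 rP] := filterI pos inD.
have r2 : - (r / 2) < 0 by rewrite oppr_lt0 divr_gt0.
have [] := rP (- (r / 2)).
- by rewrite /= sub0r opprK gtr0_norm ?divr_gt0// ltr_pdivrMr// ltr_pMr// ltr1n.
- by rewrite lt_eqF.
set h := - (r / 2) in r2 *; rewrite mxE mxE => P1 [Dh Qh].
have : 0 <= f (h *: v + x) ord0 ord0.
  rewrite fE//; have [u [[_ du] du'] <-] := Dh.
  rewrite (coord_mapE (cA Ac))//.
  have : chart_cod c' (chart_map c' u) by exists u.
  by rewrite KE => -[].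
have fx0 : f x ord0 ord0 = 0 by rewrite fx.
rewrite mxE fx0 oppr0 addr0 nmulr_rgt0 ?invr_lt0// in P1.
by rewrite leNgt P1.
Qed.

Lemma bdry_chart c p : A c -> chart_dom c p -> bdry A p ->
  open_in_half_space (chart_cod c) /\ chart_map c p ord0 ord0 = 0.
Proof.
move=> Ac dp [c' Ac' [dp' hc' p0]].
have nn := boundary_not_interior Ac Ac' dp dp' hc' p0.
have cx : chart_cod c (chart_map c p) by exists p.
have [_ oc _ _ _] := cA Ac.
case: oc => [oc|hc]; first by case: nn; exact: open_nbhs_nbhs.
split=> //; apply/eqP; apply: contrapT => /negP x0; apply: nn.
have [K [oK KE]] := hc; rewrite KE in cx *; have [Kx hx] := cx.
apply: filterI; first exact: open_nbhs_nbhs.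
have x_gt0 : 0 < chart_map c p ord0 ord0 by rewrite lt0r x0.
exact: half_space_nbhs.
Qed.

Lemma interior_chart_nbhs c p : A c -> chart_dom c p -> ~ bdry A p ->
  nbhs (chart_map c p) (chart_cod c).
Proof.
move=> Ac dp nb.
have cx : chart_cod c (chart_map c p) by exists p.
have [_ oc _ _ _] := cA Ac.
case: oc => [oc|hc]; first exact: open_nbhs_nbhs.
have x0 : chart_map c p ord0 ord0 != 0.
  by apply/eqP => x0; apply: nb; exists c.
have [K [oK KE]] := hc; rewrite KE in cx *; have [Kx hx] := cx.
apply: filterI; first exact: open_nbhs_nbhs.
have x_gt0 : 0 < chart_map c p ord0 ord0 by rewrite lt0r x0.
exact: half_space_nbhs.
Qed.

Lemma open_setC_bdry : open (~` bdry A).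
Proof.
rewrite openE => p nb; have [c Ac dp] := covA p.
have cn := interior_chart_nbhs Ac dp nb.
have cc : {for p, continuous (chart_map c)} := chart_continuous (cA Ac) dp.
have n1 : \forall q \near p, nbhs (chart_map c q) (chart_cod c).
  have : \forall y \near chart_map c p, nbhs y (chart_cod c).
    exact: near_join cn.
  by move/cc.
have n2 : \forall q \near p, chart_dom c q.
  by apply: open_nbhs_nbhs; split=> //; exact: oA.
apply: filterS2 n1 n2 => q cq dq [c' Ac' [dq' hc' q0]].
exact: (boundary_not_interior Ac Ac' dq dq' hc' q0 cq).
Qed.

End boundary.

(** * The reflection of the collar coordinates *)

Section flip.
Variables (R : realType) (n : nat).

(** The coordinate expression, in the glued collars, of the inclusion of the
    copy [b], whose collar parameter is nonpositive for [b = false]. *)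
Definition flip (b : bool) (x : 'rV[R]_n.+1) : 'rV[R]_n.+1 :=
  set_coord0 (if b then x ord0 ord0 else - x ord0 ord0) x.

Lemma flip_true x : flip true x = x.
Proof. by apply/rowP => j; rewrite mxE; case: eqP => [->|]. Qed.

Lemma flipK b : involutive (flip b).
Proof.
move=> x; apply/rowP => j; rewrite !mxE eqxx; case: eqP => // ->.
by case: b; rewrite ?opprK.
Qed.

Lemma flip_linear b : linear (flip b).
Proof.
move=> a x y; apply/rowP => j; rewrite !mxE; case: eqP => [_|//].
by case: b; rewrite // opprD mulrN.
Qed.

HB.instance Definition _ b := GRing.isLinear.Build R 'rV[R]_n.+1 'rV[R]_n.+1
  _ (flip b) (flip_linear b).

Lemma flip_continuous b : continuous (flip b).
Proof.
move=> x; apply/continuous_mxP => i j.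
have c0 (k : 'I_n.+1) :
    {for x, continuous (fun y : 'rV[R]_n.+1 => y ord0 k)}.
  exact: (@coord_continuous R 1 n.+1 ord0 k).
have -> : (fun y => flip b y i j) =
    if (j == ord0) && ~~ b then (fun y => - y ord0 j) else (fun y => y ord0 j).
  by apply/funext => y; rewrite mxE; case: eqP => [->|_]; case: b.
by case: ifP => _; [apply: continuousN|]; exact: c0.
Qed.

Lemma diff_flip (f : 'rV[R]_n.+1 -> 'rV[R]_n.+1) b x v :
  differentiable f x -> differentiable (flip b \o f) x /\
  'd (flip b \o f) x v = flip b ('d f x v).
Proof.
move=> df; have db : differentiable (flip b) (f x).
  by apply: linear_differentiable; exact: flip_continuous.
split; first exact: differentiable_comp.
have C : 'd (flip b \o f) x = 'd (flip b) (f x) \o 'd f x :> (_ -> _).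
  exact: diff_comp.
have L : 'd (flip b) (f x) = flip b :> (_ -> _).
  by apply: diff_lin; exact: flip_continuous.
exact: (etrans (congr1 (fun h => h v) C) (congr1 (fun h => h ('d f x v)) L)).
Qed.

Lemma smooth_on_flip (V : normedModType R) (S : set V)
    (f : V -> 'rV[R]_n.+1) b :
  smooth_on S f -> smooth_on S (flip b \o f).
Proof.
move=> sf x Sx; have [Q [F [oQ Qx CF FE]]] := sf x Sx.
exists Q, (flip b \o F); split=> //; last first.
  by move=> y Qy Sy; rewrite /= FE.
move=> k; apply/(C_on_mxP _ _ oQ) => i j; rewrite (ord1 i).
have Cj l := (C_on_mxP _ _ oQ).1 (CF k) ord0 l.
pose e : R := if (j == ord0) && ~~ b then -1 else 1.
apply: (C_on_ext oQ _ (C_onM oQ (C_on_cst k e oQ) (Cj j))) => y _.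
rewrite /= !mxE /e; case: eqP => [->|_]; last by rewrite [LHS]mul1r.
by case: b @e => e /=; [rewrite [LHS]mul1r | rewrite [LHS]mulN1r].
Qed.

End flip.

(** * The topology of the double *)

Local Open Scope quotient_scope.

Section double_top.
Variables (R : realType) (T : topologicalType) (n : nat).
Variable A : set (chart R T n).
Local Notation DM := (manifold_double A).

Lemma double_eqP (x y : T * bool) :
  \pi_({eq_quot double_equiv A}) x = \pi_({eq_quot double_equiv A}) y ->
  x.1 = y.1 /\ (x.2 = y.2 \/ bdry A x.1).
Proof.
move/eqmodP; rewrite /= /double_rel => /andP[/eqP-> /orP[/eqP->|/asboolP]].
  by split; [|left].
by split; [|right].
Qed.

(** The two copies of a boundary point are one point of the double, which has
    an unspecified side. *)
Lemma fold_side_copy (p : T) (b : bool) :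
  fold (copy_incl A b p) = p /\ (side (copy_incl A b p) = b \/ bdry A p).
Proof.
have := @double_eqP (repr (copy_incl A b p)) (p, b).
rewrite reprK => /(_ erefl) /= [E1 E2]; split; first exact: E1.
by case: E2 => [E2|E2]; [left | right; rewrite -E1].
Qed.

Lemma fold_copy b p : fold (copy_incl A b p) = p.
Proof. by have [] := fold_side_copy p b. Qed.

Lemma side_copy b p : ~ bdry A p -> side (copy_incl A b p) = b.
Proof. by move=> nb; have [_ []] := fold_side_copy p b. Qed.

Lemma copy_fold (q : DM) : copy_incl A (side q) (fold q) = q.
Proof.
rewrite /copy_incl /side /fold -surjective_pairing.
exact: (@reprK _ {eq_quot double_equiv A} q).
Qed.

Lemma copy_continuous b : continuous (copy_incl A b).
Proof.
pose pi := \pi_(quotient_topology {eq_quot double_equiv A}).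
move=> p; apply: (@continuous_comp _ _ _ (fun p => (p, b)) pi).
  2: exact: pi_continuous.
move=> W [[P Q] [/= Pp Qb] PQ]; apply: filterS Pp => q Pq.
by apply: (PQ (q, b)); split=> //; exact: nbhs_singleton Qb.
Qed.

Lemma open_manifold_double (D : set DM) :
  (forall b, open (copy_incl A b @^-1` D)) -> open D.
Proof.
move=> oD; rewrite /open /= /quotient_open openE => -[p b] Dp.
exists (copy_incl A b @^-1` D, [set b]).
  split=> /=; last exact: discrete_set1.
  by apply: open_nbhs_nbhs; split=> //; exact: oD.
by move=> [q b'] [/= Dq ->].
Qed.

End double_top.

(** * The geodesic collar *)

Lemma set_coord0K (R : realType) (n : nat) (s t : R) (x : 'rV[R]_n.+1) :
  set_coord0 s (set_coord0 t x) = set_coord0 s x.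
Proof. by apply/rowP => j; rewrite !mxE; case: eqP. Qed.

Lemma set_coord0_id (R : realType) (n : nat) (x : 'rV[R]_n.+1) :
  set_coord0 (x ord0 ord0) x = x.
Proof. by apply/rowP => j; rewrite !mxE; case: eqP => [->|]. Qed.

Lemma set_coord0E (R : realType) (n : nat) (t : R) (x : 'rV[R]_n.+1) :
  set_coord0 t x ord0 ord0 = t.
Proof. by rewrite mxE eqxx. Qed.

Lemma set_coord0_continuous (R : realType) (n : nat) (t : R) :
  continuous (@set_coord0 R n t).
Proof.
move=> x; apply/continuous_mxP => i j.
have -> : (fun y => set_coord0 t y i j) =
    if j == ord0 then (fun=> t) else (fun y : 'rV[R]_n.+1 => y ord0 j).
  by apply/funext => y; rewrite mxE; case: eqP.
case: ifP => _; first exact: cst_continuous.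
exact: (@coord_continuous R 1 n.+1 ord0 j).
Qed.

Section collar.
Variables (R : realType) (T : topologicalType) (n : nat).
Variables (A : set (chart R T n)) (g : tensor_field R T n).
Hypothesis hA : smooth_manifold A.
Variables (V : set (R * T)) (rho : R * T -> T) (sigma : T -> R * T).
Hypothesis hcollar : geodesic_collar A g V rho sigma.

Let cA c (Ac : A c) : is_chart c := manifold_chart hA Ac.
Let oA c (Ac : A c) : open (chart_dom c) := manifold_chart_open hA Ac.
Let covA p : exists2 c, A c & chart_dom c p := manifold_cover hA p.

Local Notation U := (rho @` V).

Lemma collar_open : open U.
Proof. by case: hcollar. Qed.

Lemma collar_sigmaK z : V z -> sigma (rho z) = z.
Proof. by case: hcollar => _ _ _ + _; apply. Qed.

Lemma collar_rhoK p : U p -> V (sigma p) /\ rho (sigma p) = p.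
Proof. by move=> [z Vz <-]; rewrite collar_sigmaK. Qed.

Lemma collar_cylinder z : V z -> 0 <= z.1 /\ bdry A z.2.
Proof. by case: hcollar => -[[ O' _ ->] _] _ _ _ _ []. Qed.

(** The normal geodesic of length 0 ends where it starts. *)
Lemma collar_bdry p : bdry A p -> [/\ V (0, p), U p & sigma p = (0, p)].
Proof.
case: hcollar => -[_ V0] Vexp _ _ _ bp.
have Vp := V0 p bp.
have rp : rho (0, p) = p.
  by have [b [gam [_ _ _ [E1 E2] _]]] := Vexp 0 p Vp; rewrite -E2.
split=> //; first by exists (0, p).
by rewrite -[in LHS]rp collar_sigmaK.
Qed.

Lemma sigma_continuous p : U p -> {for p, continuous sigma}.
Proof.
by case: hcollar => _ _ oU _ [_ [cs _]]; exact: open_within_cvg.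
Qed.

Lemma open_collar_dom c : A c ->
  open [set p | U p /\ chart_dom c (sigma p).2].
Proof.
move=> Ac; have := @open_setI_preimage _ _ U (chart_dom c) (snd \o sigma)
  collar_open (oA Ac).
apply=> p Up; apply: continuous_comp; first exact: sigma_continuous.
exact: cvg_snd.
Qed.

Local Notation cyl c := (cylinder_chart A c).

(** By the invariance of the boundary, every chart sends boundary points to
    points whose first coordinate vanishes, so nothing is lost when
    [cylinder_chart] overwrites that coordinate by the collar parameter. *)
Lemma cylinder_chartK c z : A c -> V z -> chart_dom c z.2 ->
  chart_inv (cyl c) (chart_map (cyl c) z) = z.
Proof.
move=> Ac Vz dz /=; have [_ bz] := collar_cylinder Vz.
have [_ x0] := bdry_chart hA Ac dz bz.
rewrite set_coord0E set_coord0K -[X in set_coord0 X]x0 set_coord0_id.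
by rewrite (chart_invK (cA Ac) dz) -surjective_pairing.
Qed.

(** A point [x'] of the half-space close to [chart_map (cyl c') z] is the
    image of (x'_0, m'), where m' is the boundary point with coordinates (0,
    x'_1, ...); this pair is close to [z], so it belongs to [V] and [rho] maps
    it into [c]. *)
Lemma collar_rel_nbhs c c' z : A c -> A c' -> V z -> chart_dom c' z.2 ->
  chart_dom c (rho z) ->
  rel_nbhs (coord_dom (cyl c') c V rho) (chart_map (cyl c') z).
Proof.
move=> Ac Ac' Vz dz dr; set x := chart_map _ z.
have [[[ O' oO VE] _] _ _ _ [[cr _] _]] := hcollar.
have [z0 bz] := collar_cylinder Vz.
have [[K [oK KE]] m0] := bdry_chart hA Ac' dz bz.
set y := chart_map c' z.2 in m0.
have hx : half_space x by rewrite /half_space /= mxE eqxx.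
have yE : set_coord0 0 x = y.
  by rewrite /x /= set_coord0K -[X in set_coord0 X]m0 set_coord0_id.
have cy : chart_cod c' y by exists z.2.
have Ky : K y by move: cy; rewrite KE => -[].
have [ O1 [oO1 O1z O1r]] := within_open_nbhs cr Vz
  (open_nbhs_nbhs (conj (oA Ac) dr)).
have : nbhs z (O' `&` O1).
  apply: open_nbhs_nbhs; split; first exact: openI.
  by split=> //; move: Vz; rewrite VE => -[].
move=> [[N1 N2] [/= N1z N2z] N12].
have [_ _ _ _ ci] := cA Ac'.
have N2y : nbhs (chart_inv c' y) N2 by rewrite (chart_invK (cA Ac') dz).
have [ O2 [oO2 O2y O2N]] := within_open_nbhs ci cy N2y.
right; split=> //.
have n1 : \forall x' \near x, N1 ((x' : 'rV[R]_n.+1) ord0 ord0).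
  have : nbhs (x ord0 ord0) N1 by rewrite /x set_coord0E.
  exact: (@coord_continuous R 1 n.+1 ord0 ord0 x).
have n2 : \forall x' \near x, (K `&` O2) (set_coord0 0 x').
  apply: (@set_coord0_continuous R n 0 x); rewrite yE.
  by apply: open_nbhs_nbhs; split=> //; exact: openI.
have : nbhs x (fun x' : 'rV[R]_n.+1 =>
    half_space x' -> coord_dom (cyl c') c V rho x').
  apply: (@filterS2 _ (nbhs x) (nbhs_filter x) _ _ _ _ n1 n2).
  move=> x' N1x' [Kx' O2x'] hx'.
  set y' := set_coord0 0 x' in Kx' O2x'.
  have cy' : chart_cod c' y'.
    by rewrite KE; split=> //; rewrite /half_space /= set_coord0E.
  have [m' dm' Em'] := cy'.
  have im' : chart_inv c' y' = m' by rewrite -Em' (chart_invK (cA Ac')).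
  have bm' : bdry A m'.
    exists c' => //; split=> //; first by exists K.
    by rewrite Em' set_coord0E.
  have N2m' : N2 m' by rewrite -im'; exact: O2N.
  have [ O'm' O1m'] := N12 (x' ord0 ord0, m') (conj N1x' N2m').
  have Vm' : V (x' ord0 ord0, m') by rewrite VE; split.
  exists (x' ord0 ord0, m').
    by split; [split=> //; split=> //; exact: collar_cylinder Vm' | exact: O1r].
  by rewrite /= Em' /y' set_coord0K set_coord0_id.
by [].
Qed.

End collar.

(** * Charts and metric of the double *)

Section double.
Variables (R : realType) (T : topologicalType) (n : nat).
Variables (A : set (chart R T n)) (g : tensor_field R T n).
Hypothesis hA : smooth_manifold A.
Variables (V : set (R * T)) (rho : R * T -> T) (sigma : T -> R * T).
Hypothesis hcollar : geodesic_collar A g V rho sigma.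

Let cA c (Ac : A c) : is_chart c := manifold_chart hA Ac.
Let oA c (Ac : A c) : open (chart_dom c) := manifold_chart_open hA Ac.
Let covA p : exists2 c, A c & chart_dom c p := manifold_cover hA p.
Let smA c c' (Ac : A c) (Ac' : A c') :
  smooth_on (coord_dom c c' setT id) (coord_map c c' id) :=
  manifold_transition hA Ac Ac'.

Local Notation U := (rho @` V).
Local Notation cyl c := (cylinder_chart A c).
Local Notation DA := (@double_atlas R T n A V rho sigma).
Local Notation iota b := (copy_incl A b).
Local Notation int_chart b c := (interior_chart A b c).
Local Notation col_chart c := (collar_chart A V rho sigma c).

Lemma interior_chart_dom b b' c p : chart_dom (int_chart b' c) (iota b p) <->
  [/\ chart_dom c p, ~ bdry A p & b = b'].
Proof.
rewrite /= fold_copy; split=> [[dp nb <-]|[dp nb <-]]; split=> //.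
  by rewrite side_copy.
by rewrite side_copy.
Qed.

Lemma collar_chart_dom b c p : chart_dom (col_chart c) (iota b p) <->
  U p /\ chart_dom c (sigma p).2.
Proof. by rewrite /= fold_copy. Qed.

(** On the boundary [side] is unspecified, but the collar parameter is then
    0. *)
Lemma collar_chartE b c p : A c -> U p ->
  chart_map (col_chart c) (iota b p) = flip b (chart_map (cyl c) (sigma p)).
Proof.
move=> Ac Up; rewrite /= fold_copy.
have /= := collar_bdry hcollar (p := p).
have /= := side_copy (A := A) b (p := p).
case: (sigma p) => t m /= sb bb.
rewrite /flip set_coord0E set_coord0K; congr set_coord0.
have [bp|nbp] := pselect (bdry A p); last by rewrite sb.
by have [_ _ [-> _]] := bb bp; rewrite oppr0; do 2 case: ifP.
Qed.

(** For the charts of the interior this is where the boundary has to be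
    closed. *)
Lemma double_dom_open b d : DA d -> open (iota b @^-1` chart_dom d).
Proof.
move=> [c Ac [[b' ->]|->]]; last first.
  have -> : iota b @^-1` chart_dom (col_chart c) =
      [set p | U p /\ chart_dom c (sigma p).2].
    apply/seteqP; split=> p; first exact: (collar_chart_dom b c p).1.
    exact: (collar_chart_dom b c p).2.
  exact: (open_collar_dom hA hcollar).
have [bb'|bb'] := eqVneq b b'; last first.
  have -> : iota b @^-1` chart_dom (int_chart b' c) = set0.
    apply/seteqP; split=> p // /interior_chart_dom[_ _ E].
    by rewrite E eqxx in bb'.
  exact: open0.
have -> : iota b @^-1` chart_dom (int_chart b' c) = chart_dom c `&` ~` bdry A.
  apply/seteqP; split=> p; first by move=> /interior_chart_dom[].
  by move=> [dp nb]; apply/interior_chart_dom.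
by apply: openI; [exact: oA | exact: (open_setC_bdry hA)].
Qed.

Lemma double_chart_open d : DA d -> open (chart_dom d).
Proof.
by move=> Dd; apply: open_manifold_double => b; exact: double_dom_open.
Qed.

Lemma double_cover q : exists2 d, DA d & chart_dom d q.
Proof.
rewrite -(copy_fold q); set b := side q; set p := fold q.
have [c Ac dp] := covA p.
have [bp|nb] := pselect (bdry A p).
  exists (col_chart c); first by exists c => //; right.
  have [Vp Up sp] := collar_bdry hcollar bp.
  by apply/collar_chart_dom; rewrite sp.
exists (int_chart b c); first by exists c => //; left; exists b.
by apply/interior_chart_dom.
Qed.

Lemma double_smooth b c d : A c -> DA d ->
  smooth_on (coord_dom c d setT (iota b)) (coord_map c d (iota b)).
Proof.
move=> Ac [c' Ac' [[b' ->]|->]].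
  have E : coord_map c (int_chart b' c') (iota b) = coord_map c c' id.
    by apply/funext => x; rewrite /coord_map /= fold_copy.
  rewrite E; apply: smooth_on_subset (smA Ac Ac').
  move=> x [p [[_ dp] /interior_chart_dom[dp' _ _]] <-].
  by exists p.
have [_ _ _ _ [_ [_ sm]]] := hcollar.
have sc := sm c (cyl c') Ac (imageP _ Ac').
apply: (smooth_on_ext (f := flip b \o coord_map c (cyl c') sigma)).
  move=> x [p [[_ dp] /collar_chart_dom[Up dsp]] <-].
  rewrite [RHS](coord_mapE (cA Ac))// collar_chartE//.
  by congr (flip b _); exact: (coord_mapE (cA Ac)).
apply: smooth_on_flip; apply: smooth_on_subset sc.
move=> x [p [[_ dp] /collar_chart_dom[Up dsp]] <-].
exists p => //; split; first by split.
split=> //; apply: (collar_cylinder hcollar).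
by have [] := collar_rhoK hcollar Up.
Qed.

Lemma interior_chart_metric G b c p v w : twofold_copy V rho sigma g G ->
  A c -> chart_dom c p -> ~ bdry A p ->
  bilin (g c (chart_map c p)) v w =
  bilin (G (int_chart b c) (chart_map c p)) v w.
Proof.
move=> hG Ac dp nb.
have Dd : DA (int_chart b c) by exists c => //; left; exists b.
have dq : chart_dom (int_chart b c) (iota b p) by apply/interior_chart_dom.
have dI : differentiable (@id 'rV[R]_n.+1) (chart_map c p) by [].
rewrite (pullback_diff v w (hG b) Ac Dd (cA Ac) (double_dom_open b Dd) dp dq
  openT I _ dI); last first.
  move=> y _ [q [[_ dq'] _] <-].
  by rewrite (coord_mapE (cA Ac))//= fold_copy.
by rewrite !diff_val /= fold_copy.
Qed.

(** [P] extends the coordinate expression of [rho] and has the one of [sigma]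
    as a left inverse. The inclusion [iota b] read in the collar chart is
    [flip b] after that left inverse, so it maps ['d P z v] to [flip b v]. As
    [g] does not depend on [b], the metric of the double is invariant under
    reflection. *)
Lemma collar_chart_metric c c' p : A c -> A c' -> U p -> chart_dom c p ->
  chart_dom c' (sigma p).2 ->
  let z := chart_map (cyl c') (sigma p) in
  exists Q P, [/\ open Q, Q z, forall y, Q y -> differentiable P y,
    forall y, Q y -> coord_dom (cyl c') c V rho y ->
      P y = coord_map (cyl c') c rho y &
    forall G b v, twofold_copy V rho sigma g G ->
      bilin (g c (chart_map c p)) ('d P z v) ('d P z v) =
      bilin (G (col_chart c') (flip b z)) (flip b v) (flip b v)].
Proof.
move=> Ac Ac' Up dp ds z.
have [_ _ _ _ [[_ smr] [_ sms]]] := hcollar.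
have [Vs rs] := collar_rhoK hcollar Up.
have zD : rel_nbhs (coord_dom (cyl c') c V rho) z.
  by apply: (collar_rel_nbhs hA hcollar) => //; rewrite rs.
have [Q [P [oQ Qz CP PE dP]]] :=
  smooth_on_diff (smr (cyl c') c (imageP _ Ac') Ac) (rel_nbhs_self zD).
have cylK y : V y -> chart_dom c' y.2 ->
    coord_map (cyl c') c rho (chart_map (cyl c') y) = chart_map c (rho y).
  by move=> Vy dy; rewrite /coord_map (cylinder_chartK hA hcollar).
have Pz : P z = chart_map c p by rewrite PE ?cylK ?rs//; exact: rel_nbhs_self.
set S := coord_dom c (cyl c') U sigma.
have Sx : S (chart_map c p).
  exists p => //; split; first by split.
  by split=> //; exact: (collar_cylinder hcollar).
have [Q' [F [oQ' Qx CF FE dF]]] :=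
  smooth_on_diff (sms c (cyl c') Ac (imageP _ Ac')) Sx.
exists Q, P; split=> // G b v hG.
have cP y : Q y -> {for y, continuous P}.
  by move=> Qy; exact: C_on_continuous (CP 0%N) Qy.
pose O' := Q `&` P @^-1` Q'.
have oO : open O' by exact: open_setI_preimage.
have Oz : O' z by split=> //; rewrite /= Pz.
have FP y : (coord_dom (cyl c') c V rho `&` O') y -> F (P y) = y.
  move=> [Dy [Qy Q'y]]; have := Q'y; rewrite /= PE//.
  have [u [[Vu [cu du]] dru] <-] := Dy.
  rewrite cylK// => Q'u; rewrite FE//.
    by rewrite (coord_mapE (cA Ac))// (collar_sigmaK hcollar).
  exists (rho u) => //; split; first by split=> //; exists u.
  by rewrite /preimage /= (collar_sigmaK hcollar).
have dPz : differentiable P z by exact: dP.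
have dFx : differentiable F (P z) by apply: dF; rewrite Pz.
have K := diff_cancel (rel_nbhsI zD (open_nbhs_nbhs (conj oO Oz))) FP dPz dFx v.
have Dd : DA (col_chart c') by exists c' => //; right.
have dq : chart_dom (col_chart c') (iota b p) by apply/collar_chart_dom.
have [dfF dfE] := diff_flip b ('d P z v) dFx.
have dfx : differentiable (flip b \o F) (chart_map c p) by rewrite -Pz.
have fE y : Q' y -> coord_dom c (col_chart c') setT (iota b) y ->
    (flip b \o F) y = coord_map c (col_chart c') (iota b) y.
  move=> Q'y [q [[_ dq'] /collar_chart_dom[Uq dsq]] qE]; move: Q'y; rewrite -qE.
  move=> Q'q; rewrite [RHS](coord_mapE (cA Ac))// collar_chartE//.
  congr (flip b _); rewrite FE//; first exact: (coord_mapE (cA Ac)).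
  exists q => //; split; first by split.
  split=> //; apply: (collar_cylinder hcollar).
  by have [] := collar_rhoK hcollar Uq.
have pb := pullback_diff ('d P z v) ('d P z v) (hG b) Ac Dd (cA Ac)
  (double_dom_open b Dd) dp dq oQ' Qx fE dfx.
apply: (etrans pb); rewrite collar_chartE//.
have E : 'd (flip b \o F) (chart_map c p) ('d P z v) = flip b v.
  by rewrite -Pz; apply: (etrans dfE); rewrite K.
by rewrite E.
Qed.

Lemma twofold_unique G G' d q v : twofold_copy V rho sigma g G ->
  twofold_copy V rho sigma g G' -> DA d -> chart_dom d q ->
  bilin (G d (chart_map d q)) v v = bilin (G' d (chart_map d q)) v v.
Proof.
move=> hG hG' [c' Ac' dE]; rewrite -(copy_fold q).
set b := side q; set p := fold q; case: dE => [[b' ->]|->].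
  move=> /interior_chart_dom[dp nb _]; rewrite /= fold_copy.
  by rewrite -!(interior_chart_metric b' _ _ _ Ac' dp nb).
move=> /collar_chart_dom[Up ds]; have [c Ac dp] := covA p.
have [Q [P [_ _ _ _ H]]] := collar_chart_metric Ac Ac' Up dp ds.
have := etrans (esym (H G b (flip b v) hG)) (H G' b (flip b v) hG').
by rewrite flipK collar_chartE.
Qed.

End double.

(** * Summing local distance estimates *)

(** The lower bounds on the increments of [J] convert bounds in terms of the
    speed at one time into bounds that can be added. *)
Lemma integral_primitive (R : realType) (a b : R) (v : R -> R) : a < b ->
  {within `[a, b], continuous v} ->
  exists J : R -> R, [/\ J a = 0,
    (\int[lebesgue_measure]_(s in `[a, b]) (v s)%:E = (J b)%:E)%E &
    forall s s' m, a <= s -> s < s' -> s' <= b ->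
      (forall t, t \in `[s, s'] -> m <= v t) -> m * (s' - s) <= J s' - J s].
Proof.
move=> ab cv.
have iv : lebesgue_measure.-integrable `[a, b] (EFin \o v).
  by apply: continuous_compact_integrable => //; exact: segment_compact.
pose J (s : R) := Rintegral lebesgue_measure `[a, s] v.
have sub s s' : a <= s -> s' <= b -> `]s, s'] `<=` `[a, b].
  move=> as_ sb t /=; rewrite !in_itv /= => /andP[st ts].
  by rewrite (le_trans as_ (ltW st)) (le_trans ts).
have sub0 s' : s' <= b -> `[a, s'] `<=` `[a, b].
  by move=> sb t /=; rewrite !in_itv /= => /andP[-> ts]; rewrite (le_trans ts).
exists J; split.
- by rewrite /J set_itv1 Rintegral_set1.
- rewrite /J /Rintegral fineK//; exact: integrable_fin_num.
move=> s s' m as_ ss' sb mv.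
have iv' : lebesgue_measure.-integrable `[a, s'] (EFin \o v).
  by apply: integrableS iv => //; exact: sub0.
have iv'' : lebesgue_measure.-integrable `]s, s'] (EFin \o v).
  by apply: integrableS iv => //; exact: sub.
rewrite /J Rintegral_itvB//; last by rewrite bnd_simp ltW.
have -> : m * (s' - s) = \int[lebesgue_measure]_(t in `]s, s']) m.
  rewrite Rintegral_cst//= lebesgue_measure_itv /= lte_fin ss'.
  by rewrite -EFinB.
apply: le_Rintegral => //.
  have im : lebesgue_measure.-integrable `[s, s'] (EFin \o cst m).
    apply: continuous_compact_integrable; first exact: segment_compact.
    by apply: continuous_subspaceT => x; exact: cst_continuous.
  by apply: integrableS im => //; exact: subset_itv_oc_cc.
by move=> t /= ts; apply: mv; exact: subset_itv_oc_cc ts.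
Qed.

(** The times [s] with the required bound from [a] to [s] have a supremum. The
    bounds to the left of it show that it is such a time, and those to the
    right that it equals [b]. *)
Lemma dist_le_local_length (R : realType) (a b : R) (D : R -> R -> \bar R)
    (J : R -> R) :
  a < b ->
  (forall r s t x y, D r s < x -> D s t < y -> D r t < x + y)%E ->
  (forall e : R, 0 < e -> forall s, s \in `[a, b] ->
     exists2 d : R, 0 < d & forall t, t \in `[a, b] -> `|t - s| < d ->
       (s < t -> (D s t < (J t - J s + e * (t - s))%:E)%E) /\
       (t < s -> (D t s < (J s - J t + e * (s - t))%:E)%E)) ->
  (D a b <= (J b - J a)%:E)%E.
Proof.
move=> ab tri loc; apply/lee_addgt0Pr => e0 e00.
(* the local errors e (t - s) add up to e0 over [a, b] *)
pose e := e0 / (b - a).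
have ba : 0 < b - a by rewrite subr_gt0.
have e_gt0 : 0 < e by exact: divr_gt0.
pose B s := J s - J a + e * (s - a).
pose E := [set s | s \in `[a, b] /\ (s = a \/ (D a s < (B s)%:E)%E)].
have Ea : E a by split; [rewrite in_itv /= lexx ltW | left].
have supE : has_sup E.
  split; first by exists a.
  by exists b => s [+ _]; rewrite in_itv /= => /andP[].
have step s t : E s -> s < t -> t \in `[a, b] ->
    (D s t < (J t - J s + e * (t - s))%:E)%E -> E t.
  move=> [sab Es] st tab Dst; split=> //; right.
  case: Es => [E0|Das]; first by rewrite -E0 in Dst *; rewrite /B -E0.
  have := tri _ _ _ _ _ Das Dst; rewrite -EFinD.
  by congr (_ < _%:E)%E; rewrite /B; ring.
set sg := sup E.
have sab : sg \in `[a, b].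
  rewrite in_itv /=; apply/andP; split; first exact: sup_upper_bound.
  apply: sup_le_ub; first by exists a.
  by move=> s [+ _]; rewrite in_itv /= => /andP[].
have [d d0 dP] := loc e e_gt0 sg sab.
have Esg : E sg.
  have [s Es ds] := sup_adherent d0 supE.
  have s_le : s <= sg by apply: sup_upper_bound.
  have [->//|s_ne] := eqVneq sg s.
  have s_lt : s < sg by rewrite lt_neqAle s_le eq_sym s_ne.
  have [sab' _] := Es; apply: (step s) => //.
  apply: (dP s sab' _).2 => //.
  by rewrite distrC ger0_norm ?subr_ge0// ltrBlDr -ltrBlDl.
have Eb : E b.
  have [<-//|sb] := eqVneq sg b.
  have sb' : sg < b.
    by rewrite lt_neqAle sb; move: sab; rewrite in_itv /= => /andP[].
  exfalso.
  pose t := Num.min (sg + d / 2) b.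
  have st : sg < t by rewrite lt_min sb' andbT ltrDl divr_gt0.
  have tab : t \in `[a, b].
    rewrite in_itv /= ge_min lexx orbT andbT.
    move: sab; rewrite in_itv /= => /andP[as_ _].
    exact: le_trans as_ (ltW st).
  have td : `|t - sg| < d.
    rewrite gtr0_norm ?subr_gt0// ltrBlDl.
    apply: (@le_lt_trans _ _ (sg + d / 2)); first by rewrite ge_min lexx.
    by rewrite ltrD2l ltr_pdivrMr// ltr_pMr// ltr1n.
  have Et := step _ _ Esg st tab ((dP t tab td).1 st).
  by have := sup_upper_bound supE Et; rewrite leNgt st.
have [_ [E0|Dab]] := Eb; first by rewrite E0 ltxx in ab.
apply/ltW; apply: (lt_le_trans Dab); rewrite -EFinD lee_fin /B lerD2l.
by rewrite /e divfK ?gt_eqF.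
Qed.

(** * Inclusion and folding do not increase distances *)

(** If a map into M has the derivative [w] along a filter of increments, its
    distance to the base point grows at most at the rate given by the norm of
    [w]. *)
Lemma dist_lt_quotient (R : realType) (T : topologicalType) (n : nat)
    (A : set (chart R T n)) (g : tensor_field R T n) (c : chart R T n) (p : T)
    (q : R -> T) (w : 'rV[R]_n.+1) (eps : R) (H : set_system R)
    {FH : Filter H} :
  smooth_manifold A -> riemannian_metric A g -> A c -> chart_dom c p ->
  0 < eps -> (\forall h \near H, h != 0) -> h @[h --> H] --> (0 : R) ->
  (\forall h \near H, chart_dom c (q h)) ->
  h^-1 *: (chart_map c (q h) - chart_map c p) @[h --> H] --> w ->
  let K := Num.sqrt (bilin (g c (chart_map c p)) w w) + eps in
  \forall h \near H, (riemannian_dist A g p (q h) < (K * `|h|)%:E)%E /\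
                     (riemannian_dist A g (q h) p < (K * `|h|)%:E)%E.
Proof.
move=> hA hg Ac dp eps0 nh0 h0 dq Qw K; set x := chart_map c p.
pose N (u : 'rV[R]_n.+1) := Num.sqrt (bilin (g c x) u u).
have w1 : 0 < `|w| + 1 by rewrite ltr_wpDl.
pose e := eps / (`|w| + 1).
have e0 : 0 < e by exact: divr_gt0.
have [r r0 rP] := dist_chart_le hA hg Ac dp e0.
pose Q h := h^-1 *: (chart_map c (q h) - x).
have cB : bilin (g c x) (Q h) (Q h) @[h --> H] --> bilin (g c x) w w.
  by apply: bilin_cvg => //; exact: cvg_cst.
have cN : N (Q h) @[h --> H] --> N w.
  by apply: (cvg_comp _ Num.sqrt cB); exact: sqrt_continuous.
have cK : N (Q h) + e * `|Q h| @[h --> H] --> N w + e * `|w|.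
  apply: cvgD => //; apply: cvgM; first exact: cvg_cst.
  exact: cvg_norm.
have ltK : N w + e * `|w| < K.
  rewrite /K ltrD2l /e mulrAC ltr_pdivrMr// ltr_pM2l//.
  by rewrite ltrDl.
have n1 : \forall h \near H, N (Q h) + e * `|Q h| < K := cvgr_lt _ cK _ ltK.
have cD : `|h *: Q h| @[h --> H] --> `|(0 : R) *: w|.
  by apply: cvg_norm; exact: cvgZ.
have rw : `|(0 : R) *: w| < r by rewrite scale0r normr0.
have n2 : \forall h \near H, `|h *: Q h| < r := cvgr_lt _ cD _ rw.
near=> h.
have hn0 : h != 0 by near: h.
have E : chart_map c (q h) - x = h *: Q h.
  by rewrite /Q scalerA mulfV// scale1r.
have wr : `|chart_map c (q h) - x| < r.
  by rewrite E; near: h; exact: n2.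
have dqh : chart_dom c (q h) by near: h.
have [] := rP (q h) dqh wr.
rewrite -/x E sqrt_bilinZ normrZ mulrCA -mulrDr -/(N _).
have lt : `|h| * (N (Q h) + e * `|Q h|) < K * `|h|.
  by rewrite mulrC ltr_pM2r ?normr_gt0//; near: h; exact: n1.
by move=> d1 d2; split; [apply: (le_lt_trans d1) | apply: (le_lt_trans d2)];
  rewrite lte_fin.
Unshelve. all: by end_near. Qed.

Section lipschitz.
Variables (R : realType) (T : topologicalType) (n : nat).
Variables (A : set (chart R T n)) (g : tensor_field R T n).
Hypothesis hA : smooth_manifold A.
Hypothesis hg : riemannian_metric A g.
Variables (V : set (R * T)) (rho : R * T -> T) (sigma : T -> R * T).
Hypothesis hcollar : geodesic_collar A g V rho sigma.

Let cA c (Ac : A c) : is_chart c := manifold_chart hA Ac.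
Let oA c (Ac : A c) : open (chart_dom c) := manifold_chart_open hA Ac.
Let covA p : exists2 c, A c & chart_dom c p := manifold_cover hA p.

Local Notation U := (rho @` V).
Local Notation cyl c := (cylinder_chart A c).
Local Notation DA := (@double_atlas R T n A V rho sigma).
Local Notation iota b := (copy_incl A b).
Local Notation int_chart b c := (interior_chart A b c).
Local Notation col_chart c := (collar_chart A V rho sigma c).
Local Notation dM := (riemannian_dist A g).

Lemma copy_piecewise_curve G b p q l : twofold_copy V rho sigma g G ->
  piecewise_curve A g q p l -> piecewise_curve DA G (iota b q) (iota b p) l.
Proof.
move=> hG; elim=> [|a' b' gam v m ab [cg sg] vE pw IH]; first exact: PwNil.
have [sg' vE'] : smooth_curve DA a' b' (iota b \o gam) /\
    is_speed DA G a' b' (iota b \o gam) v.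
  apply: (pushforward_curve (A := A) (g := g)) => //.
  - by move=> d Dd; apply: (double_dom_open hA hcollar).
  - by move=> c d Ac Dd; apply: (double_smooth hA hcollar).
  - exact: copy_continuous.
  move=> s sab; have [c Ac ds] := covA (gam s).
  have [ O1 [Gam lr]] := local_repP (oA Ac) cg (sg c Ac) sab ds.
  exists c, O1, Gam; split=> //.
  have O1s : O1 s by case: lr.
  have VR := velocity_rep ab lr O1s sab.
  have vs := vE c s Ac (conj sab ds).
  by rewrite VR in vs; exact: vs.
exact: (PwCons ab sg' vE' IH).
Qed.

Lemma dist_copy_le G b p q : twofold_copy V rho sigma g G ->
  (riemannian_dist DA G (iota b p) (iota b q) <= dM p q)%E.
Proof.
move=> hG; apply: ereal_inf_le_tmp => l pl.
exact: copy_piecewise_curve.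
Qed.

Lemma open_fold W : open W -> open (@fold R T n A @^-1` W).
Proof.
move=> oW; apply: open_manifold_double => b.
have -> : iota b @^-1` (@fold R T n A @^-1` W) = W.
  by apply/seteqP; split=> p; rewrite /preimage /= fold_copy.
exact: oW.
Qed.

Section fold_estimate.
Variables (G : tensor_field R (manifold_double A) n).
Hypothesis hG : twofold_copy V rho sigma g G.
Variables (a b : R) (gam : R -> manifold_double A) (v : R -> R).
Hypothesis ab : a < b.
Hypothesis sgam : smooth_curve DA a b gam.
Hypothesis vgam : is_speed DA G a b gam v.

Let side_filter (s : R) (pos : bool) : set_system R :=
  within [set h | s + h \in `[a, b] /\ (if pos then 0 < h else h < 0)]
    (0 : R)^'.

Let side_filter_filter s pos : Filter (side_filter s pos).
Proof. exact: within_filter. Qed.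

(** Off the boundary the fold is smooth. If the curve is on the boundary at
    [s] and has collar coordinates (t, y), then its fold has coordinates (|t|,
    y); as t vanishes at [s], the one-sided derivatives of |t| there are |t'|
    and -|t'|. *)
Lemma fold_one_sided_derivative s pos : s \in `[a, b] ->
  exists c w, [/\ A c, chart_dom c (fold (gam s)),
    \forall h \near side_filter s pos, chart_dom c (fold (gam (s + h))),
    h^-1 *: (chart_map c (fold (gam (s + h))) - chart_map c (fold (gam s)))
       @[h --> side_filter s pos] --> w &
    v s = Num.sqrt (bilin (g c (chart_map c (fold (gam s)))) w w)].
Proof.
move=> sab; have [cg sg] := sgam.
set H := side_filter s pos.
have FH : Filter H := side_filter_filter s pos.
set q0 := gam s; set p := fold q0; set b0 := side q0.
have q0E : q0 = iota b0 p by rewrite copy_fold.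
have [c Ac dp] := covA p.
have n0 : \forall h \near H, h != 0 by exact: within_dnbhs0_neq0.
have nab : \forall h \near H, s + h \in `[a, b].
  by rewrite /H /side_filter near_withinE; apply: filterE => h [].
have npos : \forall h \near H, if pos then 0 < h else h < 0.
  by rewrite /H /side_filter near_withinE; apply: filterE => h [].
have h0 : h @[h --> H] --> (0 : R) by exact: cvg_within_dnbhs0.
have sh : s + h @[h --> H] --> s.
  have : s + h @[h --> H] --> s + 0 by apply: cvgD => //; exact: cvg_cst.
  by rewrite addr0.
have ndom : \forall h \near H, chart_dom c (fold (gam (s + h))).
  have [ O1 [oO1 O1s O1d]] := within_open_nbhs cg sab
    (open_nbhs_nbhs (conj (open_fold (oA Ac)) dp)).
  have nO1 : \forall h \near H, O1 (s + h) by apply: sh; exact: open_nbhs_nbhs.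
  by near=> h; apply: O1d; [near: h | near: h].
have quot O1 (Gam : R -> 'rV[R]_n.+1) : open O1 -> O1 s ->
    (forall k, C_on k O1 Gam) ->
    h^-1 *: (Gam (s + h) - Gam s) @[h --> H] --> 'D_1 Gam s.
  move=> oO1 O1s CG.
  have dG : derivable Gam s 1 by exact: C_on_derivable (CG 1%N) O1s.
  have q' : h^-1 *: ((Gam \o shift s) (h *: (1 : R)) - Gam s) @[h --> (0 : R)^']
      --> 'D_1 Gam s by exact: dG.
  have q'' : h^-1 *: ((Gam \o shift s) (h *: (1 : R)) - Gam s) @[h --> H]
      --> 'D_1 Gam s by move=> W Wl; apply: within_dnbhs0; exact: q'.
  apply: cvg_near_eq q''; apply: nearW => h.
  by rewrite /= [_ *: 1]mulr1 (addrC h).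
have [bp|nbp] := pselect (bdry A p); last first.
  pose d := int_chart b0 c.
  have Dd : DA d by exists c => //; left; exists b0.
  have dq : chart_dom d (gam s).
    by rewrite -/q0 q0E; apply/interior_chart_dom.
  have [ O1 [Gam lr]] := local_repP (double_chart_open hA hcollar Dd) cg
    (sg d Dd) sab dq.
  have [oO1 O1s CG GE] := lr.
  exists c, ('D_1 Gam s); split=> //.
    apply: cvg_near_eq (quot O1 Gam oO1 O1s CG).
    have nO1 : \forall h \near H, O1 (s + h).
      by apply: sh; exact: open_nbhs_nbhs.
    near=> h.
    have [_ ->] : chart_dom d (gam (s + h)) /\
        Gam (s + h) = chart_map d (gam (s + h)).
      by apply: GE; near: h.
    by have [_ ->] := GE s O1s sab.
  have VR := velocity_rep ab lr O1s sab.
  have vs := vgam Dd (conj sab dq); rewrite VR in vs.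
  by rewrite (interior_chart_metric hA hcollar b0 _ _ hG Ac dp nbp).
have [Vp Up sp] := collar_bdry hcollar bp.
have ds : chart_dom c (sigma p).2 by rewrite sp.
pose d := col_chart c.
have Dd : DA d by exists c => //; right.
have dq : chart_dom d (gam s).
  by rewrite -/q0 q0E; apply/collar_chart_dom.
have [ O1 [Gam lr]] := local_repP (double_chart_open hA hcollar Dd) cg
  (sg d Dd) sab dq.
have [oO1 O1s CG GE] := lr.
pose y := 'D_1 Gam s.
set z := chart_map (cyl c) (sigma p).
have z0 : z ord0 ord0 = 0 by rewrite /z sp /= set_coord0E.
have flipz b' : flip b' z = z.
  by rewrite /flip z0 oppr0 if_same -[in LHS]z0 set_coord0_id.
have Gs : Gam s = z.
  have [_ ->] := GE s O1s sab.
  by rewrite -/q0 q0E (collar_chartE hcollar)// flipz.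
have [Q [P [oQ Qz dP PE HP]]] := collar_chart_metric hA hcollar Ac Ac Up dp ds.
(* the folded curve in collar coordinates: its parameter t is never negative *)
pose kap t := set_coord0 `|Gam t ord0 ord0| (Gam t).
have kapE t : O1 t -> t \in `[a, b] ->
    U (fold (gam t)) /\ kap t = chart_map (cyl c) (sigma (fold (gam t))) /\
    chart_dom c (sigma (fold (gam t))).2.
  move=> O1t tab; have [dt Gt] := GE t O1t tab.
  have /collar_chart_dom[Ut dst] :
      chart_dom d (iota (side (gam t)) (fold (gam t))) by rewrite copy_fold.
  split=> //; split=> //.
  have [Vt _] := collar_rhoK hcollar Ut.
  have [t0 _] := collar_cylinder hcollar Vt.
  have GE' : Gam t =
      flip (side (gam t)) (chart_map (cyl c) (sigma (fold (gam t)))).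
    by rewrite Gt -(collar_chartE hcollar)// copy_fold.
  rewrite /kap GE' /flip set_coord0E set_coord0K /= set_coord0E set_coord0K.
  by case: ifP => _; rewrite ?normrN ger0_norm.
have kaps : kap s = z by rewrite /kap Gs z0 normr0 -[in LHS]z0 set_coord0_id.
have Pkap t : O1 t -> t \in `[a, b] -> Q (kap t) ->
    chart_dom c (fold (gam t)) ->
    P (kap t) = chart_map c (fold (gam t)).
  move=> O1t tab Qk dct; have [Ut [kE dst]] := kapE t O1t tab.
  have [Vt rt] := collar_rhoK hcollar Ut.
  rewrite PE//.
    rewrite kE /coord_map (cylinder_chartK hA hcollar)//.
    by rewrite rt.
  rewrite kE; exists (sigma (fold (gam t))) => //; split.
    by split=> //; split=> //; exact: (collar_cylinder hcollar).
  by rewrite /preimage /= rt.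
pose w0 := set_coord0 (if pos then `|y ord0 ord0| else - `|y ord0 ord0|) y.
have qG : h^-1 *: (Gam (s + h) - z) @[h --> H] --> y.
  by rewrite -Gs; exact: (quot O1 Gam oO1 O1s CG).
have qk : h^-1 *: (kap (s + h) - z) @[h --> H] --> w0.
  apply: mx_cvg => i j; rewrite (ord1 i).
  have coordE (h : R) (u : 'rV[R]_n.+1) k :
      (h *: (u - z)) ord0 k = h * (u ord0 k - z ord0 k).
    by rewrite mxE mxE [in X in _ + X]mxE.
  have qGj k : (h^-1 *: (Gam (s + h) - z)) ord0 k @[h --> H] --> y ord0 k.
    exact: coord_cvg.
  have [->|j0] := eqVneq j ord0; last first.
    rewrite mxE (negbTE j0); apply: cvg_near_eq (qGj j); apply: nearW => h.
    by rewrite !coordE /kap [set_coord0 _ _ _ _]mxE (negbTE j0).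
  have cabs : `|(h^-1 *: (Gam (s + h) - z)) ord0 ord0| @[h --> H] -->
      `|y ord0 ord0|.
    exact: cvg_norm.
  have habs h : `|(h^-1 *: (Gam (s + h) - z)) ord0 ord0| =
      `|h|^-1 * `|Gam (s + h) ord0 ord0|.
    by rewrite coordE z0 subr0 normrM normfV.
  rewrite mxE eqxx; case: (pos) npos => hpos.
    apply: cvg_near_eq cabs; near=> h.
    have hp : 0 < h by near: h; exact: hpos.
    by rewrite habs coordE set_coord0E z0 subr0 (gtr0_norm hp).
  have cabs' : - `|(h^-1 *: (Gam (s + h) - z)) ord0 ord0| @[h --> H] -->
      - `|y ord0 ord0| by exact: cvgN.
  apply: cvg_near_eq cabs'; near=> h.
  have hp : h < 0 by near: h; exact: hpos.
  rewrite habs coordE set_coord0E z0 subr0 (ltr0_norm hp).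
  by rewrite invrN mulNr opprK.
have ck : kap (s + h) @[h --> H] --> z.
  have c1 : h *: (h^-1 *: (kap (s + h) - z)) + z @[h --> H] --> 0 *: w0 + z.
    by apply: cvgD; [exact: cvgZ | exact: cvg_cst].
  rewrite scale0r add0r in c1; apply: cvg_near_eq c1; near=> h.
  have hn0 : h != 0 by near: h; exact: n0.
  by rewrite scalerA mulfV// scale1r subrK.
have qP := cvg_quotient_comp FH (dP z Qz) n0 ck qk.
exists c, ('d P z w0); split=> //.
  apply: cvg_near_eq qP.
  have nO1 : \forall h \near H, O1 (s + h) by apply: sh; exact: open_nbhs_nbhs.
  have nQ : \forall h \near H, Q (kap (s + h)).
    by apply: ck; exact: open_nbhs_nbhs.
  have Pz : P z = chart_map c p by rewrite -kaps Pkap// kaps.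
  near=> h; rewrite Pz Pkap//; near: h.
  - exact: nO1.
  - exact: nab.
  - exact: nQ.
  - exact: ndom.
have VR := velocity_rep ab lr O1s sab.
have vs := vgam Dd (conj sab dq); rewrite VR in vs.
have cz : curve_coord d gam s = z by rewrite -Gs; have [_ ->] := GE s O1s sab.
rewrite cz in vs; rewrite vs.
(* w0 is the velocity or its mirror image, which have the same norm since flip
   fixes z *)
have [b' b'E] : exists b', flip b' w0 = y.
  have [e|e] := eqVneq (w0 ord0 ord0) (y ord0 ord0).
    exists true; rewrite flip_true /w0; apply/rowP => j; rewrite mxE.
    by case: eqP => // ->; rewrite /w0 set_coord0E in e.
  exists false; apply/rowP => j; rewrite !mxE eqxx; case: eqP => // ->.
  move: e; rewrite /w0 set_coord0E.
  by case: (pos); case: (ger0P (y ord0 ord0)) => _; rewrite ?eqxx ?opprK ?eqxx.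
have := HP G b' w0 hG; rewrite b'E flipz.
by move=> ->.
Unshelve. all: by end_near. Qed.

Lemma fold_dist_local s e pos : s \in `[a, b] -> 0 < e ->
  exists2 d : R, 0 < d & forall h, h != 0 -> `|h| < d -> s + h \in `[a, b] ->
    (if pos then 0 < h else h < 0) ->
    (dM (fold (gam s)) (fold (gam (s + h))) < ((v s + e) * `|h|)%:E)%E /\
    (dM (fold (gam (s + h))) (fold (gam s)) < ((v s + e) * `|h|)%:E)%E.
Proof.
move=> sab e0.
have [c [w [Ac dc ndc Qw vs]]] := fold_one_sided_derivative pos sab.
set H := side_filter s pos.
have FH : Filter H := side_filter_filter s pos.
have n0 : \forall h \near H, h != 0 by exact: within_dnbhs0_neq0.
have h0 : h @[h --> H] --> (0 : R) by exact: cvg_within_dnbhs0.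
have := dist_lt_quotient hA hg Ac dc e0 n0 h0 ndc Qw.
rewrite /= -vs => -[d /= d0 dP]; exists d => // h hn0 hd hab hpos.
by apply: dP => //=; rewrite sub0r normrN.
Qed.

(** At [s] the speed bounds the distance up to e / 2, and by continuity the
    integral of the speed bounds it up to another e / 2. *)
Lemma fold_curve_le : {within `[a, b], continuous v} ->
  (dM (fold (gam a)) (fold (gam b)) <=
   \int[lebesgue_measure]_(s in `[a, b]) (v s)%:E)%E.
Proof.
move=> cv; have [J [Ja Jb Jle]] := integral_primitive ab cv.
rewrite Jb -(subr0 (J b)) -Ja.
pose D s t := dM (fold (gam s)) (fold (gam t)).
apply: (dist_le_local_length (D := D) ab).
  by move=> r s t x y; exact: dist_triangle_lt.
move=> e e0 s sab; have e2 : 0 < e / 2 by exact: divr_gt0.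
have [d1 d10 H1] := fold_dist_local true sab e2.
have [d2 d20 H2] := fold_dist_local false sab e2.
have [d3 d30 H3] : exists2 d : R, 0 < d & forall t, t \in `[a, b] ->
    `|t - s| < d -> v s - e / 2 <= v t.
  have /cvgrPdist_lt/(_ _ e2) := within_cvg cv sab.
  rewrite near_withinE => /nbhs_ballP[d /= d0 dP]; exists d => // t tab td.
  have : `|v s - v t| < e / 2 by apply: dP => //; rewrite -ball_normE /= distrC.
  by move=> /ltW; rewrite ler_norml => /andP[_]; rewrite lerBlDr lerBlDl addrC.
pose d := Num.min d1 (Num.min d2 d3).
have d0 : 0 < d by rewrite !lt_min d10 d20 d30.
have between t u : t \in `[a, b] -> `|t - s| < d ->
    (s <= u <= t) || (t <= u <= s) -> v s - e / 2 <= v u.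
  move=> tab; rewrite !lt_min => /and3P[_ _ td].
  move: sab tab; rewrite !in_itv /= => /andP[as_ sb] /andP[at_ tb] hu.
  apply: H3; first by rewrite in_itv /=; apply/andP; case/orP: hu; lra.
  move: td; rewrite !ltr_norml => /andP[t1 t2]; apply/andP.
  by case/orP: hu; lra.
exists d => // t tab td.
have tE : t = s + (t - s) by rewrite addrC subrK.
move: (td); rewrite !lt_min => /and3P[td1 td2 _].
move: (sab) (tab); rewrite !in_itv /= => /andP[as_ sb] /andP[at_ tb].
have tab' : s + (t - s) \in `[a, b] by rewrite -tE.
split=> [st|ts].
  have hn0 : t - s != 0 by rewrite subr_eq0 gt_eqF.
  have hpos : 0 < t - s by rewrite subr_gt0.
  have [D1 _] := H1 (t - s) hn0 td1 tab' hpos.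
  rewrite -tE in D1; apply: (lt_le_trans D1); rewrite lee_fin.
  rewrite gtr0_norm ?subr_gt0//.
  have := Jle s t (v s - e / 2) as_ st tb
    (fun u ut => between t u tab td (introT orP (or_introl ut))).
  by move=> ?; lra.
have hn0 : t - s != 0 by rewrite subr_eq0 lt_eqF.
have hneg : t - s < 0 by rewrite subr_lt0.
have [_ D2] := H2 (t - s) hn0 td2 tab' hneg.
rewrite -tE in D2; apply: (lt_le_trans D2); rewrite lee_fin.
rewrite ltr0_norm ?subr_lt0//.
have := Jle t s (v s - e / 2) at_ ts sb
  (fun u ut => between t u tab td (introT orP (or_intror ut))).
by move=> ?; lra.
Qed.

End fold_estimate.

(** The strict bound leaves room for an intermediate bound [y] on the length
    of the rest of the curve. *)
Lemma fold_piecewise_lt G (p q : manifold_double A) l :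
  twofold_copy V rho sigma g G -> riemannian_metric DA G ->
  piecewise_curve DA G q p l -> forall x : R, (l < x%:E)%E ->
  (dM (fold p) (fold q) < x%:E)%E.
Proof.
move=> hG rG; elim=> [|a b gam v m ab sg vE pw IH] x lx.
  exact: le_lt_trans (dist_refl _ _ _) lx.
have cv : {within `[a, b], continuous v}.
  apply: (speed_continuous _ _ rG ab sg vE).
    by move=> d; exact: (double_chart_open hA hcollar).
  by move=> r; exact: (double_cover hA hcollar).
have le := fold_curve_le hG ab sg vE cv.
have [J [_ Jb _]] := integral_primitive ab cv.
rewrite Jb in le lx.
have [y [my yx]] : exists y : R, (m < y%:E)%E /\ J b + y < x.
  case: m lx {pw IH} => [m| |] /=.
  - rewrite -EFinD !lte_fin => lx; exists ((m + (x - J b)) / 2).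
    by rewrite lte_fin; split; lra.
  - by rewrite addey.
  - by move=> _; exists (x - J b - 1); rewrite ltNyr; split=> //; lra.
have D2 := IH y my.
have D1 : (dM (fold (gam a)) (fold (gam b)) < (x - y)%:E)%E.
  by apply: (le_lt_trans le); rewrite lte_fin; lra.
by have := dist_triangle_lt D1 D2; rewrite -EFinD subrK.
Qed.

Lemma is_speed_twofold G G' a b gam v :
  twofold_copy V rho sigma g G -> twofold_copy V rho sigma g G' ->
  is_speed DA G a b gam v -> is_speed DA G' a b gam v.
Proof.
move=> hG hG' vE d s Dd [sab ds]; rewrite (vE d s Dd (conj sab ds)).
by rewrite (twofold_unique hA hcollar _ hG hG' Dd ds).
Qed.

(** Lengths of curves depend only on the quadratic forms, so that [G] may be
    replaced by a Riemannian metric. *)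
Lemma piecewise_curve_twofold G G' p q l :
  twofold_copy V rho sigma g G -> twofold_copy V rho sigma g G' ->
  piecewise_curve DA G q p l -> piecewise_curve DA G' q p l.
Proof.
move=> hG hG'; elim=> [|a b gam v m ab sg vE pw IH]; first exact: PwNil.
exact: PwCons ab sg (is_speed_twofold hG hG' vE) IH.
Qed.

Lemma dist_fold_lt G p q (x : R) : twofold_copy V rho sigma g G ->
  doubling_metric A V rho sigma g ->
  (riemannian_dist DA G p q < x%:E)%E -> (dM (fold p) (fold q) < x%:E)%E.
Proof.
move=> hG [G' rG' hG'] /ereal_inf_lt[l pl lx].
exact: fold_piecewise_lt hG' rG' (piecewise_curve_twofold hG hG' pl) _ lx.
Qed.

End lipschitz.

Theorem theorem2p2 (R : realType) (n : nat) (M : topologicalType)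
    (A : set (chart R M n)) (hM : smooth_manifold A)
    (hconn : connected [set: M]) (hbdry : bdry A !=set0)
    (g : tensor_field R M n) (hg : riemannian_metric A g)
    (V : set (R * M)) (rho : R * M -> M) (sigma : M -> R * M)
    (hcollar : geodesic_collar A g V rho sigma)
    (hcomplete : complete_metric A g)
    (hdoubling : doubling_metric A V rho sigma g)
    (G : tensor_field R (manifold_double A) n)
    (hG : twofold_copy V rho sigma g G) :
  complete_metric (double_atlas V rho sigma) G.
Proof.
move=> u Cu.
have [l lP] : exists l, forall e : R, 0 < e -> exists N : nat, forall i : nat,
    (N <= i)%N -> (riemannian_dist A g (fold (u i)) l < e%:E)%E.
  apply: (hcomplete (fun i => fold (u i))) => e e0.
  have [N NP] := Cu e e0; exists N => i j Ni Nj.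
  exact: (dist_fold_lt hM hg hcollar hG hdoubling (NP i j Ni Nj)).
(* one copy of M contains infinitely many terms *)
have [b bP] : exists b, forall N, exists2 i, (N <= i)%N & side (u i) = b.
  have [H|H] := pselect (forall N, exists2 i, (N <= i)%N & side (u i) = true).
    by exists true.
  exists false => N; apply: contrapT => H'; apply: H => N'.
  exists (maxn N N'); first exact: leq_maxr.
  apply: contrapT => /negP/negbTE H; apply: H'.
  by exists (maxn N N') => //; exact: leq_maxl.
exists (copy_incl A b l) => e e0; have e2 : 0 < e / 2 by exact: divr_gt0.
have [N1 N1P] := Cu _ e2; have [N2 N2P] := lP _ e2.
exists N1 => i N1i.
have [j jN sj] := bP (maxn N1 N2).
have N1j : (N1 <= j)%N by apply: leq_trans jN; exact: leq_maxl.
have N2j : (N2 <= j)%N by apply: leq_trans jN; exact: leq_maxr.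
rewrite [e]splitr EFinD; apply: dist_triangle_lt (N1P i j N1i N1j) _.
rewrite -(copy_fold (u j)) sj.
exact: le_lt_trans (dist_copy_le hM hcollar _ _ _ hG) (N2P j N2j).
Qed.
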